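(* Let $\kappa>0$, $\alpha\in(0,1)$ and $\beta>0$, and let $g,y_0,y_+^*,y_-^*$ be as defined in the context. There exists $z_c>g(y_0)$ such that, defining for $z\in\mathbb{R}\setminus\{z_c\}$ $$\mathfrak{p}(z)=\begin{cases}\kappa|y_+^*(z)|^{-\alpha}&\text{if }z>z_c,\\ \kappa|y_-^*(z)|^{-\alpha}&\text{if }z<z_c,\end{cases}$$ the following holds. Let $f_0\in C^1(\mathbb{R},\mathbb{R})$ satisfy $$f_0(y)=\frac{\kappa(1+o_{y\to\pm\infty}(1))}{|y|^{\alpha}\ln^{\beta}(|y|)}\quad\text{and}\quad f_0'(y)=\frac{-\alpha\kappa(1+o_{y\to\pm\infty}(1))}{y|y|^{\alpha}\ln^{\beta}(|y|)},$$ and let $f$ be the solution of the viscous Burgers equation $\partial_t f-\partial_x^2 f+f\,\partial_x f=0$ on $\mathbb{R}$ with initial data $f_0$. For $t$ large enough let $\mu(t)>1$ be the solution of $$\mu(t)^{1+\alpha}\ln^{\beta}(\mu(t))=t.$$ Then for any $z\in\mathbb{R}\setminus\{z_c\}$, $$\frac{t}{\mu(t)}f(z\mu(t),t)\to\mathfrak{p}(z)\quad\text{as }t\to+\infty,$$ and for any $\varepsilon>0$ the convergence is uniform on $\left[-\frac1\varepsilon,\frac1\varepsilon\right]\setminus[z_c-\varepsilon,z_c+\varepsilon]$. Moreover, $\mathfrak{p}$ is the same profile as in the case without logarithm: for every $\tilde f_0\in C^1(\mathbb{R},\mathbb{R})$ with $\tilde f_0(y)=\frac{\kappa(1+o_{y\to\pm\infty}(1))}{|y|^\alpha}$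 and $\tilde f_0'(y)=\frac{-\alpha\kappa(1+o_{y\to\pm\infty}(1))}{y|y|^\alpha}$, the solution $\tilde f$ of the viscous Burgers equation with initial data $\tilde f_0$ satisfies $t^{\frac{\alpha}{1+\alpha}}\tilde f\left(z\,t^{\frac1{1+\alpha}},t\right)\to\mathfrak{p}(z)$ as $t\to+\infty$ for every $z\in\mathbb{R}\setminus\{z_c\}$.
   Context: For $\kappa>0$, $\alpha\in(0,1)$, set $g(y)=y+\frac{\kappa}{|y|^{\alpha}}$ for $y\neq0$ and $y_0=(\kappa\alpha)^{\frac{1}{1+\alpha}}$, so that $g(y_0)=\kappa^{\frac{1}{1+\alpha}}\left(\alpha^{\frac{1}{1+\alpha}}+\alpha^{-\frac{\alpha}{1+\alpha}}\right)>0$. The function $y_+^*:(g(y_0),+\infty)\to(y_0,+\infty)$ is the inverse of the increasing bijection $g:(y_0,+\infty)\to(g(y_0),+\infty)$, and $y_-^*:\mathbb{R}\to(-\infty,0)$ is the inverse of the increasing bijection $g:(-\infty,0)\to\mathbb{R}$. The solution of the viscous Burgers equation with initial data $f_0$ is the one given by the Hopf-Cole formula: for $t>0$, $x\in\mathbb{R}$, $$f(x,t)=\frac{\int_{\mathbb{R}}\frac{x-y}{t}\exp\left(-\frac{(x-y)^2}{4t}-\frac12\int_0^y f_0(z)\,dz\right)dy}{\int_{\mathbb{R}}\exp\left(-\frac{(x-y)^2}{4t}-\frac12\int_0^y f_0(z)\,dz\right)dy}.$$ The notation $o_{y\to\pm\infty}(1)$ denotes a function of $y$ tending to $0$ both as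 $y\to+\infty$ and as $y\to-\infty$; $\ln^\beta(s)$ means $(\ln s)^\beta$. *)

(* Defs.v *)
From mathcomp Require Import all_boot all_order all_algebra.
From mathcomp Require Import all_classical all_reals all_analysis.

Set Implicit Arguments.
Unset Strict Implicit.
Unset Printing Implicit Defensive.

Import Order.TTheory GRing.Theory Num.Theory.
Import numFieldNormedType.Exports.

Local Open Scope classical_set_scope.
Local Open Scope ring_scope.

Section profile.
Context {R : realType}.
Implicit Types kappa alpha zc y z : R.

Definition gfun kappa alpha y : R := y + kappa / `|y| `^ alpha.

Definition y0 kappa alpha : R := (kappa * alpha) `^ (1 + alpha)^-1.

(* 'pinv_d A f is the inverse of f restricted to A, as a function on f @` A;
   its values outside f @` A are irrelevant *)
Definition yplus kappa alpha : R -> R :=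
  'pinv_(fun=> 0) `]y0 kappa alpha, +oo[ (gfun kappa alpha).

Definition yminus kappa alpha : R -> R :=
  'pinv_(fun=> 0) `]-oo, 0[ (gfun kappa alpha).

(* the value at z = zc is a dummy *)
Definition profile kappa alpha zc z : R :=
  if zc < z then kappa * `|yplus kappa alpha z| `^ (- alpha)
  else kappa * `|yminus kappa alpha z| `^ (- alpha).

(* mu_log alpha beta t is the solution m > 1 of m^(1 + alpha) ln^beta(m) = t *)
Definition mu_log (alpha beta : R) : R -> R :=
  'pinv_(fun=> 0) `]1, +oo[ (fun m => m `^ (1 + alpha) * ln m `^ beta).

End profile.

Section initial_data.
Context {R : realType}.
Implicit Types f h : R -> R.

Definition C1 f : Prop := (forall y, derivable f y 1) /\ continuous f^`()%classic.

(* f(y) = h(y) (1 + o(1)), with o(1) tending to 0 both at +oo and at -oo *)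
Definition equiv_pm_infty f h : Prop :=
  exists o : R -> R,
    [/\ o y @[y --> +oo] --> 0,
        o y @[y --> -oo] --> 0,
        \forall y \near +oo, f y = h y * (1 + o y) &
        \forall y \near -oo, f y = h y * (1 + o y)].

End initial_data.

Section hopf_cole.
Context {R : realType}.
Local Notation leb := (@lebesgue_measure R).

(* the oriented integral of f from 0 to y *)
Definition int0 (f : R -> R) (y : R) : R :=
  if 0 <= y then \int[leb]_(z in `[0, y]) f z
  else - \int[leb]_(z in `[y, 0]) f z.

Definition hopf_cole_weight (f0 : R -> R) (x t y : R) : R :=
  expR (- ((x - y) ^+ 2 / (4 * t)) - 2^-1 * int0 f0 y).

(* the solution at (x, t), t > 0, of f_t - f_xx + f f_x = 0, f(., 0) = f0 *)
Definition burgers_solution (f0 : R -> R) (x t : R) : R :=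
  (\int[leb]_y ((x - y) / t * hopf_cole_weight f0 x t y)) /
  (\int[leb]_y hopf_cole_weight f0 x t y).

End hopf_cole.

(* Main.v *)
Require Import Defs.
From mathcomp Require Import all_boot all_order all_algebra.
From mathcomp Require Import all_classical all_reals all_analysis.
From mathcomp Require Import measurable_realfun ring lra.

(** Let L = ln^beta, or L = 1 for data without logarithm, let mu be such that
    t = mu^(1+alpha) L(mu), and put y = mu u and lambda = mu^2 / t. In these
    variables the Hopf-Cole formula says that (t / mu) f(z mu, t) is the mean of
    z - u under the Gibbs density proportional to

      exp (- (lambda / 2) ((z - u)^2 / 2 + W_t(u))),
      W_t(u) = (1 / lambda) * (integral of f0 from 0 to mu u).

    Here lambda = mu^(1-alpha) / L(mu) tends to infinity, and W_t tends to the
    primitive F of kappa / |u|^alpha, because L varies slowly: this is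
    [int0_asymptotics], which rests on the pointwise bound [log_tail]. By Laplace's
    principle the density concentrates at the global minimizer of
    Phi_z(u) = (z - u)^2 / 2 + F(u). The critical points of Phi_z are the solutions
    of g(u) = z, where z - u = kappa |u|^(-alpha); so the limit is the announced
    profile as soon as the global minimizer is known. It is [yminus z] for small z
    and [yplus z] for large z, and it switches exactly once ([global_min_switch]):
    raising z always favours the positive side. The logarithm has disappeared from
    Phi_z, which is why the profile is the same with and without it.

    The concentration is not localized near the minimizer; convexity does the work
    instead. Jensen's inequality for the exponential tilt from z to z + h says that the
    mean of u is a subgradient in z of a convex function, which is the logarithm of the
    total mass divided by lambda / 2, up to a quadratic term ([gibbs_mass_tilt]). That
    logarithm is close to minus the minimal energy ([gibbs_mean_le]). Two-sided bounds
    on the masses, uniform for z in a compact set, therefore squeeze the mean of u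
    between u*(z - h) and u*(z + h), where u* is the minimizer. On each side of the
    switching value u* is Lipschitz ([ustar_lipschitz]), which gives uniform
    convergence away from that value
    ([burgers_profile]), and pointwise convergence as a particular case. *)

Set Implicit Arguments.
Unset Strict Implicit.
Unset Printing Implicit Defensive.

Import Order.TTheory GRing.Theory Num.Theory.
Import numFieldNormedType.Exports.

Local Open Scope classical_set_scope.
Local Open Scope ring_scope.

(** * Real powers and partial inverses *)

Lemma powRV (R : realType) (a b : R) : 0 <= a -> a^-1 `^ b = (a `^ b)^-1.
Proof. by move=> a0; rewrite -(powR_inv1 a0) powRAC powR_inv1 // powR_ge0. Qed.

Lemma pinv_image_spec (R : realType) (A : set R) (f : R -> R) z :
  (f @` A) z -> A ('pinv_(fun=> 0) A f z) /\ f ('pinv_(fun=> 0) A f z) = z.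
Proof.
move=> fAz; split; last by apply: pinvK; rewrite inE.
have sA : set_surj A (f @` A) f by move=> x.
by apply: (surjpinv_image_sub (dflt := fun=> 0) sA); exists z.
Qed.

(** * The energy and its global minimizer *)

Section potential.
Context {R : realType}.
Variables kappa alpha : R.
Hypotheses (kappa_gt0 : 0 < kappa) (alpha_gt0 : 0 < alpha) (alpha_lt1 : alpha < 1).
Implicit Types z u v : R.

Local Notation g := (gfun kappa alpha).

(** The primitive vanishing at 0 of [u |-> kappa / |u| ^ alpha]. *)
Definition potential u : R :=
  Num.sg u * (kappa / (1 - alpha) * `|u| `^ (1 - alpha)).

(** Up to the factor [- lambda / 2], this is the limit of the Hopf-Cole exponent in
    the coarse variables; its critical points in [u] solve [g u = z]. *)
Definition energy z u : R := (z - u) ^+ 2 / 2 + potential u.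

Let alpha1_gt0 : 0 < 1 - alpha. Proof. by rewrite subr_gt0. Qed.

Let c_gt0 : 0 < kappa / (1 - alpha). Proof. exact: divr_gt0. Qed.

Lemma is_derive_powR_potential v : 0 < v -> is_derive v 1
    (fun w => kappa / (1 - alpha) * w `^ (1 - alpha)) (kappa / v `^ alpha).
Proof.
move=> v0; have dv := is_derive1_powR (1 - alpha) v0.
apply: (is_derive_eq (is_deriveZ (kappa / (1 - alpha)) dv)).
rewrite /GRing.scale /= mulrA divfK ?gt_eqF //.
by rewrite addrAC subrr sub0r powRN.
Qed.

Lemma is_derive_potential u : u != 0 ->
  is_derive u 1 potential (kappa / `|u| `^ alpha).
Proof.
move=> u0.
have [v0|v0] := ltrP 0 u.
  have := is_derive_powR_potential v0; rewrite ger0_norm ?ltW //.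
  apply: near_eq_is_derive.
  near=> w; have w0 : 0 < w by near: w; exact: lt_nbhsr.
  by rewrite /potential gtr0_sg // mul1r gtr0_norm.
have {}v0 : u < 0 by rewrite lt_neqAle u0.
have Nu : 0 < - u by rewrite oppr_gt0.
rewrite ltr0_norm //.
have d1 := is_derive_powR_potential Nu.
have d2 : is_derive u 1 (-%R : R -> R) (-1) by exact: is_deriveNid.
have d3 := is_deriveN (@is_derive1_comp R _ _ u _ _ d1 d2).
rewrite mulrN1 opprK in d3; apply: near_eq_is_derive d3.
near=> w; have w0 : w < 0 by near: w; exact: lt_nbhsl.
by rewrite /potential ltr0_sg // mulN1r ltr0_norm.
Unshelve. all: by end_near. Qed.

Lemma norm_potential u : `|potential u| = kappa / (1 - alpha) * `|u| `^ (1 - alpha).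
Proof.
rewrite /potential; have [->|u0] := eqVneq u 0.
  by rewrite sgr0 mul0r normr0 powR0 ?gt_eqF // mulr0.
rewrite normrM normr_sg u0 mul1r ger0_norm //.
by rewrite mulr_ge0 ?powR_ge0 // ltW.
Qed.

Lemma potential0 : potential 0 = 0.
Proof. by rewrite /potential sgr0 mul0r. Qed.

Lemma potential_ge0 u : 0 <= u -> 0 <= potential u.
Proof.
by move=> u0; rewrite /potential !mulr_ge0 ?sgr_ge0 ?powR_ge0 // ltW // invr_gt0.
Qed.

Lemma potentialN u : potential (- u) = - potential u.
Proof. by rewrite /potential sgrN normrN mulNr. Qed.

Lemma potential_homo : {homo potential : u v / u <= v}.
Proof.
have h u v : 0 <= u -> u <= v -> potential u <= potential v.
  rewrite le_eqVlt => /predU1P[<- v0|u0 uv]; first by rewrite potential0 potential_ge0.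
  have v0 := lt_le_trans u0 uv.
  rewrite /potential !gtr0_sg // !mul1r !gtr0_norm // ler_pM2l //.
  by apply: (ge0_ler_powR (ltW alpha1_gt0)); rewrite ?nnegrE //; exact: ltW.
move=> u v uv; have [u0|u0] := leP 0 u; first exact: h.
rewrite -[u]opprK -[v]opprK potentialN [leRHS]potentialN lerN2.
have [v0|v0] := leP v 0; first by apply: h; rewrite ?lerN2 // oppr_ge0.
apply: (@le_trans _ _ 0); first by rewrite potentialN oppr_le0 potential_ge0 // ltW.
by rewrite potential_ge0 // oppr_ge0 ltW.
Qed.

Lemma norm_potential_le u : `|potential u| <= kappa / (1 - alpha) * (1 + `|u|).
Proof.
rewrite norm_potential ler_pM2l //; have [u1|u1] := leP 1 `|u|.
  have := ler_powR u1 (_ : 1 - alpha <= 1); rewrite powRr1 //.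
  by rewrite gerBl (ltW alpha_gt0) => /(_ isT)/le_trans; apply; rewrite lerDr.
have := ge0_ler_powR (ltW alpha1_gt0) (normr_nneg u) (_ : 1 \is Num.nneg) (ltW u1).
by rewrite nnegrE ler01 powR1 => /(_ isT)/le_trans; apply; rewrite lerDl.
Qed.

Lemma continuous_potential : continuous potential.
Proof.
move=> u; have [->|u0] := eqVneq u 0; last first.
  by apply/differentiable_continuous/derivable1_diffP; case: (is_derive_potential u0).
rewrite /continuous_at potential0; apply/cvgr0Pnorm_le => e e0.
set d := (e / (kappa / (1 - alpha))) `^ (1 - alpha)^-1.
have d0 : 0 < d by rewrite powR_gt0 // divr_gt0.
near=> w; rewrite norm_potential -ler_pdivlMl // mulrC.
have wd : `|w| <= d.
  near: w; have := @nbhs0_le R R d d0.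
  by apply: filterS => w.
have := ge0_ler_powR (ltW alpha1_gt0) (normr_nneg w) _ wd.
rewrite nnegrE (ltW d0) => /(_ isT)/le_trans; apply.
rewrite /d -powRrM mulVf ?gt_eqF // powRr1 // ltW //.
exact: divr_gt0.
Unshelve. all: by end_near. Qed.

Lemma is_derive_energy z u : u != 0 -> is_derive u 1 (energy z) (g u - z).
Proof.
move=> u0; have d1 := is_derive_potential u0.
have d2 : is_derive u 1 (fun w : R => (z - w) ^+ 2 / 2) (u - z).
  have d3 : is_derive u 1 (cst z - id) (0 - 1 : R) by exact: is_deriveB.
  have d4 := @is_deriveX R R _ 2 u 1 _ d3.
  have d5 := is_deriveZ 2^-1 d4.
  rewrite (_ : (fun w : R => _) = 2^-1 \*: (cst z - id) ^+ 2); last first.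
    by apply/funext => w; rewrite /= mulrC exprfctE.
  by apply: (is_derive_eq d5); rewrite /GRing.scale /= !fctE /=; field.
apply: (is_derive_eq (is_deriveD d2 d1)).
by rewrite /gfun; ring.
Qed.

Lemma continuous_energy z : continuous (energy z).
Proof.
move=> u; apply: cvgD; last exact: continuous_potential.
apply: cvgMl; rewrite expr2.
by apply: cvgM; apply: cvgB => //; exact: cvg_cst.
Qed.

(** [potential] is continuous but not differentiable at 0, so the mean value
    theorem is applied on an interval that does not cross the origin. *)
Lemma energy_MVT z u v : u < v -> (0 <= u \/ v <= 0) ->
  exists2 c, u < c < v & energy z v - energy z u = (g c - z) * (v - u).
Proof.
move=> uv uv0.
have [||c cuv ->] := @MVT R (energy z) (fun c => g c - z) u v uv.
- move=> x; rewrite in_itv/= => /andP[ux xv]; apply: is_derive_energy.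
  case: uv0 => h; [rewrite gt_eqF // (le_lt_trans h)//|].
  by rewrite lt_eqF // (lt_le_trans xv).
- exact/continuous_subspaceT/continuous_energy.
- by exists c => //; move: cuv; rewrite in_itv.
Qed.

(** On the negative half-line both terms of [g] increase, so [g] expands lengths
    and its inverse [yminus] is 1-Lipschitz. *)
Lemma gfun_ltN u v : u < v -> v < 0 -> v - u <= g v - g u.
Proof.
move=> uv v0; have u0 := lt_trans uv v0.
suff : kappa / `|u| `^ alpha <= kappa / `|v| `^ alpha by rewrite /gfun; lra.
rewrite ler_pM2l // lef_pV2 ?posrE ?powR_gt0 ?normr_gt0 ?lt_eqF //.
by rewrite ge0_ler_powR ?nnegrE ?normr_ge0 ?ltW // !ltr0_norm // ltrN2.
Qed.

Local Notation y0 := (y0 kappa alpha).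

Lemma y0_gt0 : 0 < y0. Proof. by rewrite powR_gt0 // mulr_gt0. Qed.

Lemma y0E : alpha * kappa * y0 `^ (- (1 + alpha)) = 1.
Proof.
have h : 0 < 1 + alpha by rewrite addr_gt0.
rewrite /y0 -powRrM mulrN mulVf ?gt_eqF // powR_inv1 ?(ltW (mulr_gt0 _ _)) //.
by rewrite mulrC; rewrite mulrC [alpha * _]mulrC divff // gt_eqF // mulr_gt0.
Qed.

(** The derivative of [g] on the positive half-line; it vanishes at [y0]. *)
Definition dgfun u := 1 - alpha * kappa * u `^ (- (1 + alpha)).

Lemma dgfun_lt u v : 0 < u -> u < v -> dgfun u < dgfun v.
Proof.
move=> u0 uv; have v0 := lt_trans u0 uv.
rewrite /dgfun ltrD2l ltrN2 ltr_pM2l ?mulr_gt0 // !powRN.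
rewrite ltf_pV2 ?posrE ?powR_gt0 // gt0_ltr_powR ?nnegrE ?ltW //.
by rewrite (lt_trans alpha_gt0) // ltrDr.
Qed.

Lemma dgfun_y0 : dgfun y0 = 0. Proof. by rewrite /dgfun y0E subrr. Qed.

Lemma dgfun_gt0 u : y0 < u -> 0 < dgfun u.
Proof. by move=> h; have := dgfun_lt y0_gt0 h; rewrite dgfun_y0. Qed.

Lemma dgfun_lt0 u : 0 < u -> u < y0 -> dgfun u < 0.
Proof. by move=> u0 h; have := dgfun_lt u0 h; rewrite dgfun_y0. Qed.

Lemma is_derive_gfun u : 0 < u -> is_derive u 1 g (dgfun u).
Proof.
move=> u0; have d1 := is_derive1_powR (- alpha) u0.
have d2 := is_deriveD (is_derive_id u 1) (is_deriveZ kappa d1).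
have d3 : is_derive u 1 (id + kappa \*: ((@powR R) ^~ (- alpha))) (dgfun u).
  apply: (is_derive_eq d2); rewrite /GRing.scale /= /dgfun.
  have -> : - alpha - 1 = - (1 + alpha) by ring.
  by ring.
apply: near_eq_is_derive d3.
near=> w; have w0 : 0 < w by near: w; exact: lt_nbhsr.
by rewrite /gfun gtr0_norm // -powRN.
Unshelve. all: by end_near. Qed.

Lemma continuous_gfun u : u != 0 -> {for u, continuous g}.
Proof.
move=> u0; rewrite /continuous_at /gfun; apply: cvgD => //.
have nu : 0 < `|u| by rewrite normr_gt0.
apply: cvgMr; apply: cvgV; first by rewrite gt_eqF // powR_gt0.
have cp : {for `|u|, continuous (@powR R ^~ alpha)}.
  apply/differentiable_continuous/derivable1_diffP.
  by case: (is_derive1_powR alpha nu).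
have cn : `|w| @[w --> u] --> `|u| by apply: cvg_norm.
exact: (cvg_comp _ _ cn cp).
Qed.

Lemma gfun_MVT u v : 0 < u -> u < v ->
  exists2 c, u < c < v & g v - g u = dgfun c * (v - u).
Proof.
move=> u0 uv; have [||c cuv ->] := @MVT R g dgfun u v uv.
- move=> x; rewrite in_itv/= => /andP[ux xv]; apply: is_derive_gfun.
  exact: lt_trans ux.
- apply: continuous_in_subspaceT => x; rewrite inE/= in_itv/= => /andP[ux _].
  by apply: continuous_gfun; rewrite gt_eqF // (lt_le_trans u0).
- by exists c => //; move: cuv; rewrite in_itv.
Qed.

(** The derivative of [g] is increasing and positive beyond [y0], so its value at [u]
    bounds from below all slopes to the right of [u]: away from [y0] the inverse
    [yplus] is Lipschitz. *)
Lemma gfun_ltP u v : y0 <= u -> u < v -> dgfun u * (v - u) <= g v - g u.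
Proof.
move=> yu uv; have u0 := lt_le_trans y0_gt0 yu.
have [c /andP[uc cv] ->] := gfun_MVT u0 uv.
by rewrite ler_pM2r ?subr_gt0 // ltW // dgfun_lt.
Qed.

Lemma gfun_lt u v : y0 <= u -> u < v -> g u < g v.
Proof.
move=> yu uv; have u0 := lt_le_trans y0_gt0 yu.
have [c /andP[uc cv] e] := gfun_MVT u0 uv.
rewrite -subr_gt0 e; apply: mulr_gt0; last by rewrite subr_gt0.
by apply: dgfun_gt0; exact: le_lt_trans uc.
Qed.

Lemma gfun_gt u v : 0 < u -> u < v -> v <= y0 -> g v < g u.
Proof.
move=> u0 uv vy.
have [c /andP[uc cv] e] := gfun_MVT u0 uv.
have dc : dgfun c < 0.
  by apply: dgfun_lt0; [exact: lt_trans uc|exact: lt_le_trans vy].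
by rewrite -subr_lt0 e nmulr_rlt0 ?subr_gt0.
Qed.

Lemma gfun_y0_le u : 0 < u -> g y0 <= g u.
Proof.
move=> u0; case: (ltgtP u y0) => [h|h|->//]; apply/ltW.
  exact: gfun_gt.
exact: gfun_lt.
Qed.

Lemma gfun_norm1_le u : 1 <= `|u| -> g u <= u + kappa.
Proof.
move=> u1; rewrite /gfun lerD2l ler_pdivrMr ?powR_gt0 ?(lt_le_trans ltr01) //.
rewrite ler_peMr ?(ltW kappa_gt0) //.
by have := ler_powR u1 (ltW alpha_gt0); rewrite powRr0.
Qed.

Lemma yminusP z : yminus kappa alpha z < 0 /\ g (yminus kappa alpha z) = z.
Proof.
suff h : (g @` `]-oo, 0[) z.
  by have [] := pinv_image_spec h; rewrite /= in_itv.
pose a := - (1 + `|z - kappa|).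
have a1 : 1 <= `|a| by rewrite normrN ger0_norm ?lerDl // addr_ge0.
have ga : g a <= z.
  apply: le_trans (gfun_norm1_le a1) _; rewrite /a.
  by have := ler_norm (- (z - kappa)); rewrite normrN; lra.
pose k := 1 + `|(z + 1) / kappa|.
have k1 : 1 <= k by rewrite lerDl.
have k0 : 0 < k by apply: lt_le_trans k1.
pose b := - (k `^ (- alpha^-1)).
have b0 : b < 0 by rewrite oppr_lt0 powR_gt0.
have b1 : -1 <= b.
  rewrite lerN2; have := ler_powR k1 (_ : - alpha^-1 <= 0); rewrite powRr0; apply.
  by rewrite oppr_le0 invr_ge0 ltW.
have gb : z <= g b.
  rewrite /gfun normrN ger0_norm ?powR_ge0 // -powRrM mulNr mulVf ?gt_eqF //.
  rewrite powR_inv1 ?(ltW k0) // invrK.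
  have : (z + 1) / kappa <= k by rewrite (le_trans (ler_norm _)) // lerDr.
  by rewrite ler_pdivrMr // mulrC; lra.
have ab : a <= b by rewrite (le_trans _ b1) // lerN2 lerDl.
have [||c] := @IVT R g a b z ab.
- apply: continuous_in_subspaceT => x; rewrite inE/= in_itv/= => /andP[_ xb].
  by apply: continuous_gfun; rewrite lt_eqF // (le_lt_trans xb).
- by rewrite ge_min le_max ga gb orbT.
- rewrite in_itv/= => /andP[_ cb] gc; exists c => //=.
  by rewrite in_itv/= (le_lt_trans cb).
Qed.

Lemma yplusP z : g y0 < z -> y0 < yplus kappa alpha z /\ g (yplus kappa alpha z) = z.
Proof.
move=> yz.
suff h : (g @` `]y0, +oo[) z.
  by have [] := pinv_image_spec h; rewrite /= in_itv/= andbT.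
pose b := Num.max y0 z.
have yb : y0 <= b by rewrite le_max lexx.
have gb : z <= g b.
  apply: (@le_trans _ _ b); first by rewrite le_max lexx orbT.
  by rewrite lerDl divr_ge0 ?(ltW kappa_gt0) // powR_ge0.
have [||c] := @IVT R g y0 b z yb.
- apply: continuous_in_subspaceT => x; rewrite inE/= in_itv/= => /andP[xa _].
  by apply: continuous_gfun; rewrite gt_eqF // (lt_le_trans y0_gt0).
- by rewrite ge_min le_max (ltW yz) gb orbT.
- rewrite in_itv/= => /andP[yc _] gc; exists c => //=.
  rewrite in_itv/= andbT lt_neqAle yc andbT.
  by apply/eqP => e; move: yz; rewrite e gc ltxx.
Qed.

(** On the negative half-line the energy has a single critical point, its minimum. *)
Lemma energy_yminus_min z v : v <= 0 ->
  energy z (yminus kappa alpha z) <= energy z v.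
Proof.
move=> v0; have [y_lt0 gy] := yminusP z; set y := yminus _ _ _ in y_lt0 gy *.
case: (ltgtP v y) => [vy|yv|-> //].
  have [|c /andP[vc cy] e] := @energy_MVT z v y vy; first by right; exact: ltW.
  rewrite -subr_le0 e mulr_le0_ge0 ?subr_ge0 ?(ltW vy) // subr_le0 -gy.
  by rewrite -subr_ge0 (le_trans _ (gfun_ltN cy y_lt0)) // subr_ge0 ltW.
have [|c /andP[yc cv] e] := @energy_MVT z y v yv; first by right.
rewrite -subr_ge0 e mulr_ge0 ?subr_ge0 ?(ltW yv) // -gy.
have c0 := lt_le_trans cv v0.
by rewrite -subr_ge0 (le_trans _ (gfun_ltN yc c0)) // subr_ge0 ltW.
Qed.

(** For [z <= g y0] the derivative [g - z] of the energy has no sign change on the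
    positive half-line. *)
Lemma energy_ge0_min z v : z <= g y0 -> 0 <= v -> energy z 0 <= energy z v.
Proof.
move=> zy; rewrite le_eqVlt => /predU1P[<-//|v0].
have [|c /andP[c0 cv] e] := @energy_MVT z 0 v v0; first by left.
rewrite -subr_ge0 e mulr_ge0 ?subr_ge0 ?(ltW v0) //.
exact: le_trans (gfun_y0_le c0).
Qed.

(** For [z > g y0] the energy increases, decreases down to [yplus z], then increases:
    its minimum over the positive half-line is at 0 or at [yplus z]. *)
Lemma energy_yplus_min z v : g y0 < z -> 0 <= v ->
  Num.min (energy z 0) (energy z (yplus kappa alpha z)) <= energy z v.
Proof.
move=> yz v0; have [yy gy] := yplusP yz; set y := yplus _ _ _ in yy gy *.
move: v0; rewrite le_eqVlt => /predU1P[<-|v0]; first by rewrite ge_min lexx.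
have [yv|vy] := leP y0 v.
  (* beyond y0, g - z changes sign exactly at y *)
  rewrite ge_min; apply/orP; right; case: (ltgtP v y) => [vy|vy|-> //].
    have [|c /andP[vc cy] e] := @energy_MVT z v y vy; first by left; exact: ltW.
    rewrite -subr_le0 e mulr_le0_ge0 ?subr_ge0 ?(ltW vy) // subr_le0 -gy.
    by apply/ltW/gfun_lt => //; rewrite (le_trans yv) // ltW.
  have [|c /andP[vc cy] e] := @energy_MVT z y v vy.
    by left; rewrite (le_trans (ltW y0_gt0)) // ltW.
  rewrite -subr_ge0 e mulr_ge0 ?subr_ge0 ?(ltW vy) // -gy.
  by apply/ltW/gfun_lt => //; exact: ltW.
have [gv|gv] := leP z (g v).
  (* v lies before the descending zero of g - z: the energy increases from 0 to v *)
  rewrite ge_min; apply/orP; left.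
  have [|c /andP[c0 cv] e] := @energy_MVT z 0 v v0; first by left.
  rewrite -subr_ge0 e mulr_ge0 ?subr_ge0 ?(ltW v0) // (le_trans gv) //.
  by apply/ltW/gfun_gt => //; exact: ltW.
rewrite ge_min; apply/orP; right; have vy' := lt_trans vy yy.
have [|c /andP[vc cy] e] := @energy_MVT z v y vy'; first by left; exact: ltW.
rewrite -subr_le0 e mulr_le0_ge0 ?subr_ge0 ?(ltW vy') // subr_le0.
have [yc|yc] := leP y0 c; first by rewrite -gy; apply/ltW/gfun_lt.
by rewrite (le_trans _ (ltW gv)) //; apply/ltW/gfun_gt => //; exact: ltW.
Qed.

Definition global_min z u := forall v, energy z u <= energy z v.

(** The global minimizer of the energy, once [zc] is the right switching value. *)
Definition ustar zc z :=
  if zc < z then yplus kappa alpha z else yminus kappa alpha z.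

Let yminus_min z := global_min z (yminus kappa alpha z).

Lemma energy_shift z h u : energy (z + h) u = energy z u + h * (z - u) + h ^+ 2 / 2.
Proof. by rewrite /energy; field. Qed.

(** Lowering [z] by [h] adds [h * u] to the energy up to a constant, which favours
    the negative branch: the set of [z] for which it wins is a half-line. *)
Lemma yminus_min_le z z' : z' <= z -> yminus_min z -> yminus_min z'.
Proof.
move=> zz min_z v; have [v0|v0] := leP v 0; first exact: energy_yminus_min.
have [y_lt0 _] := yminusP z.
apply: le_trans (energy_yminus_min z' (ltW y_lt0)) _.
have -> : z' = z + (z' - z) by ring.
rewrite !energy_shift lerD2r; apply: lerD; first exact: min_z.
rewrite ler_wnM2l ?subr_le0 // lerD2l lerN2.
by rewrite (le_trans (ltW y_lt0)) // ltW.
Qed.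

Lemma energy_yminus_lt0 z : energy z (yminus kappa alpha z) < energy z 0.
Proof.
have [y_lt0 gy] := yminusP z; set y := yminus _ _ _ in y_lt0 gy *.
have [|c /andP[yc c0] e] := @energy_MVT z y 0 y_lt0; first by right.
rewrite -subr_gt0 e mulr_gt0 ?subr_gt0 // -gy -subr_gt0.
by apply: lt_le_trans (gfun_ltN yc c0); rewrite subr_gt0.
Qed.

Lemma energy0r z : energy z 0 = z ^+ 2 / 2.
Proof. by rewrite /energy potential0 subr0 addr0. Qed.

(** At [z = g y0] the energy is monotone on the positive half-line, so the negative
    branch beats it by a fixed amount; the advantage survives a small increase of [z]
    because large [v] are never competitive. *)
Lemma yminus_min_gt_y0 : exists2 z, g y0 < z & yminus_min z.
Proof.
pose z0 := g y0.
have z0_gt0 : 0 < z0.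
  by rewrite ltr_wpDr ?y0_gt0 // divr_ge0 ?powR_ge0 // ltW.
pose z1 := z0 + 1; have z1_gt0 : 0 < z1 by rewrite addr_gt0.
pose y1 := yminus kappa alpha z1; have [y1_lt0 _] : y1 < 0 /\ _ := yminusP z1.
(* the gain of the negative minimum over the origin *)
pose b := z1 ^+ 2 / 2 - energy z1 y1.
have b_gt0 : 0 < b by rewrite subr_gt0 -energy0r energy_yminus_lt0.
(* on 0 < v < 2 z the increase from z0 to z0 + e costs at most e * v <= b *)
pose e := Num.min 1 (b / (2 * z1)).
have e_gt0 : 0 < e by rewrite lt_min ltr01 divr_gt0 // mulr_gt0.
have e_le1 : e <= 1 by rewrite ge_min lexx.
have e_leb : e * (2 * z1) <= b.
  by rewrite -ler_pdivlMr ?mulr_gt0 // ge_min lexx orbT.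
exists (z0 + e); first by rewrite ltrDl.
move=> v; have [v0|v0] := leP v 0; first exact: energy_yminus_min.
have [vz|vz] := leP (2 * (z0 + e)) v.
  apply: le_trans (ltW (energy_yminus_lt0 _)) _.
  rewrite energy0r /energy; have := potential_ge0 (ltW v0).
  have : 0 <= v * (v - 2 * (z0 + e)) by rewrite mulr_ge0 ?subr_ge0 // ltW.
  by rewrite !expr2; lra.
apply: le_trans (energy_yminus_min _ (ltW y1_lt0)) _.
have h0 : energy z0 0 <= energy z0 v by apply: energy_ge0_min => //; exact: ltW.
have ev : e * v <= b.
  apply: le_trans e_leb; rewrite ler_pM2l //.
  by rewrite (le_trans (ltW vz)) // ler_pM2l // lerD2l.
have -> : energy (z0 + e) y1 = (z0 + e) ^+ 2 / 2 - b + (1 - e) * y1.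
  have -> : z0 + e = z1 + (e - 1) by rewrite /z1; ring.
  by rewrite energy_shift /b; field.
have : (1 - e) * y1 <= 0 by rewrite mulr_ge0_le0 ?subr_ge0 // ltW.
rewrite energy_shift; move: h0; rewrite energy0r !expr2; lra.
Qed.

(** The energy at the competitor [v = 1] decreases like [- z] relative to
    [z ^+ 2 / 2], whereas that of the negative branch does not. *)
Lemma yminus_min_ubound : has_ubound [set z | yminus_min z].
Proof.
pose M := 2^-1 + potential 1 - energy 0 (yminus kappa alpha 0).
exists (Num.max 0 M) => z /= min_z; rewrite le_max.
have [//|z0 /=] := leP z 0.
have [y_lt0 _] := yminusP z; set y := yminus _ _ z in y_lt0 *.
have h1 := min_z 1; have h2 := energy_yminus_min 0 (ltW y_lt0).
have e1 : energy z y = energy 0 y - z * y + z ^+ 2 / 2.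
  by have := energy_shift 0 z y; rewrite add0r => ->; ring.
have : 0 <= - (z * y) by rewrite oppr_ge0 mulr_ge0_le0 // ltW.
move: h1; rewrite -/y e1 /M {2}/energy !expr2; lra.
Qed.

(** The switching value is the supremum of the [z] for which the negative branch is
    the global minimum. Beyond it some positive point does better than the negative
    branch, hence better than the origin, and then [yplus z] is the best point. *)
Lemma global_min_switch : exists2 zc, g y0 < zc &
  forall z, z != zc -> global_min z (ustar zc z).
Proof.
pose S := [set z | yminus_min z].
have [z1 yz1 Sz1] := yminus_min_gt_y0.
have supS : has_sup S by split; [exists z1|exact: yminus_min_ubound].
have z1S : z1 <= sup S by apply: ub_le_sup => //; exact: yminus_min_ubound.
exists (sup S); first exact: lt_le_trans z1S.
move=> z; rewrite /ustar neq_lt => /orP[zS|Sz].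
  rewrite ltNge (ltW zS) /=.
  have [w Sw] := @sup_adherent R S (sup S - z) (ltac:(by rewrite subr_gt0)) supS.
  by rewrite opprB addrC subrK => /ltW zw; exact: yminus_min_le Sw.
rewrite Sz; have yz : g y0 < z := lt_trans (lt_le_trans yz1 z1S) Sz.
have nS : ~ S z.
  by move=> /(ub_le_sup yminus_min_ubound); rewrite leNgt Sz.
have [v hv] : exists v, energy z v < energy z (yminus kappa alpha z).
  apply: contrapT => h; apply: nS => v; rewrite leNgt.
  by apply/negP => hv; apply: h; exists v.
have v0 : 0 <= v.
  by rewrite leNgt; apply/negP => /ltW/(energy_yminus_min z); rewrite leNgt hv.
(* the positive branch beats the negative one, which beats the origin *)
have hy : energy z (yplus kappa alpha z) < energy z (yminus kappa alpha z).
  have := le_lt_trans (energy_yplus_min yz v0) hv.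
  by rewrite gt_min ltNge (ltW (energy_yminus_lt0 z)).
move=> w; have [w0|w0] := leP w 0.
  exact: le_trans (ltW hy) (energy_yminus_min _ w0).
apply: le_trans (energy_yplus_min yz (ltW w0)).
by rewrite le_min lexx (ltW (lt_trans hy (energy_yminus_lt0 z))).
Qed.

(** At a critical point, [g u = z] reads [kappa |u| ^ -alpha = z - u]. *)
Lemma profileE zc z : g y0 < zc -> profile kappa alpha zc z = z - ustar zc z.
Proof.
move=> yzc; suff h u : g u = z -> kappa * `|u| `^ (- alpha) = z - u.
  rewrite /profile /ustar; case: ifP => [zcz|_]; last exact: h (yminusP z).2.
  exact: h (yplusP (lt_trans yzc zcz)).2.
by move<-; rewrite /gfun powRN; ring.
Qed.

Definition same_side zc z z' := (zc < z) && (zc < z') || (z < zc) && (z' < zc).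

(** Each branch is Lipschitz, with a constant that is uniform up to [zc] because
    [yplus zc] stays beyond the critical point [y0] of [g]. *)
Lemma ustar_lipschitz zc : g y0 < zc -> exists2 K, 0 < K &
  forall z z', same_side zc z z' -> z < z' ->
    ustar zc z' - ustar zc z <= K * (z' - z).
Proof.
move=> yzc; have [yc gc] := yplusP yzc; set y := yplus _ _ _ in yc gc.
have d0 := dgfun_gt0 yc.
have di0 : 0 < (dgfun y)^-1 by rewrite invr_gt0.
exists (1 + (dgfun y)^-1) => [|z z' zz' lt_zz']; first by rewrite addr_gt0.
have dz : 0 < z' - z by rewrite subr_gt0.
rewrite mulrDl mul1r; have := mulr_gt0 di0 dz; set r := _ * _ => r0.
have [le_u|lt_u] := leP (ustar zc z') (ustar zc z).
  by move: le_u; rewrite -subr_le0; lra.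
case/orP: zz' => /andP[zcz zcz']; move: lt_u; rewrite /ustar.
  rewrite zcz zcz'; have [yz gz] := yplusP (lt_trans yzc zcz).
  have [yz' gz'] := yplusP (lt_trans yzc zcz'); move=> lt_u.
  have le_d : dgfun y <= dgfun (yplus kappa alpha z).
    case: (ltgtP y (yplus kappa alpha z)) => [h|h|<-//]; last first.
      by have := gfun_lt (ltW yz) h; rewrite gz gc ltNge (ltW zcz).
    by apply/ltW/dgfun_lt => //; exact: lt_trans y0_gt0 yc.
  have := gfun_ltP (ltW yz) lt_u; rewrite gz gz' => h1.
  suff : yplus kappa alpha z' - yplus kappa alpha z <= r by lra.
  rewrite /r ler_pdivlMl // (le_trans _ h1) // ler_pM2r // subr_gt0 //.
rewrite !(lt_gtF zcz) (lt_gtF zcz') /=; have [yz gz] := yminusP z.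
have [yz' gz'] := yminusP z'; move=> lt_u.
by have := gfun_ltN lt_u yz'; rewrite gz gz'; lra.
Qed.

End potential.

(** * The Laplace principle *)

Section laplace.
Context {R : realType}.
Variables kappa alpha : R.
Hypotheses (kappa_gt0 : 0 < kappa) (alpha_gt0 : 0 < alpha) (alpha_lt1 : alpha < 1).
Local Notation leb := (@lebesgue_measure R).
Local Notation F := (potential kappa alpha).
Local Notation Phi := (energy kappa alpha).
Local Notation is_min := (global_min kappa alpha).
Local Notation c := (kappa / (1 - alpha)).

Variables (I : R -> R) (lam mu eps : R).
Implicit Types M z h u y : R.
Hypotheses (I_cont : continuous I) (lam_gt0 : 0 < lam) (mu_gt0 : 0 < mu).
Hypotheses (eps_gt0 : 0 < eps) (eps_le : eps <= 8^-1) (lam_eps : 1 <= lam * eps).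
Hypothesis I_close : forall y,
  `|I y / lam - F (y / mu)| <= eps * (1 + (y / mu) ^+ 2).

(** In the variable [u = y / mu] the exponent is [- (lam / 2)] times a perturbation
    of [Phi z u]. *)
Definition gibbs z y : R :=
  expR (- (lam / 2) * ((z - y / mu) ^+ 2 / 2 + I y / lam)).

(** For [|z| <= M]: [coerc M] enters the coercivity bound of the energy, [minsize M]
    bounds the size of its minimizers, and [errcst M] collects the upper and the lower
    errors of the Laplace estimates. *)
Definition coerc (M : R) := 3 / 2 * M ^+ 2 + c + 2 * c ^+ 2.
Definition minsize (M : R) := 1 + 4 * (M ^+ 2 / 2 + coerc M).
Definition errcst (M : R) :=
  (8 * (M ^+ 2 / 2 + coerc M) + 1) + (M + minsize M + 2 + (minsize M + 1) ^+ 2).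

Let c_gt0 : 0 < c. Proof. by rewrite divr_gt0 // subr_gt0. Qed.

Lemma sqr_norm_le (z M : R) : `|z| <= M -> z ^+ 2 <= M ^+ 2.
Proof.
move=> zM; rewrite -[leLHS]real_normK ?num_real // lerXn2r // ?nnegrE //.
exact: le_trans zM.
Qed.

Lemma energy_coercive M z u : `|z| <= M -> u ^+ 2 / 4 - coerc M <= Phi z u.
Proof.
move=> /sqr_norm_le zM; rewrite /coerc /energy.
have := norm_potential_le kappa_gt0 alpha_gt0 alpha_lt1 u.
rewrite ler_norml => /andP[h _].
have h1 : 0 <= (`|u| - 4 * c) ^+ 2 by exact: sqr_ge0.
have h2 : 0 <= (u - 4 * z) ^+ 2 by exact: sqr_ge0.
have e : `|u| * `|u| = u * u by rewrite -!expr2 real_normK // num_real.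
move: h1 h2 zM h; rewrite !expr2; set a := c; nra.
Qed.

Lemma coerc_ge0 M : 0 <= coerc M.
Proof.
have := sqr_ge0 M; have := sqr_ge0 c; have := c_gt0.
by rewrite /coerc; set a := c; set b := a ^+ 2; set d := M ^+ 2; lra.
Qed.

Lemma minsize_ge1 M : 1 <= minsize M.
Proof. by have := coerc_ge0 M; have := sqr_ge0 M; rewrite /minsize; set d := M ^+ 2; lra. Qed.

(** The perturbation is at most [eps * (1 + u ^+ 2)]. Giving up the fraction
    [8 * eps] of the energy pays for its quadratic part, by coercivity, and leaves
    [eps * u ^+ 2], hence a Gaussian of width [mu] since [1 <= lam * eps]. *)
Lemma gibbs_le M z V y : `|z| <= M -> (forall u, V <= Phi z u) ->
  V <= M ^+ 2 / 2 ->
  gibbs z y <= expR (- (lam / 2) * (V - errcst M * eps)) *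
               expR (- (y - 0) ^+ 2 / (mu ^+ 2 *+ 2)).
Proof.
move=> zM leV Vle; rewrite -expRD ler_expR subr0.
pose u := y / mu.
have -> : - y ^+ 2 / (mu ^+ 2 *+ 2) = - (u ^+ 2 / 2).
  by rewrite /u; field; rewrite gt_eqF.
have h1 := energy_coercive u zM; have h2 := leV u.
have := I_close y; rewrite -/u ler_norml => /andP[h3 _].
have E : V - errcst M * eps + eps * u ^+ 2 <= (z - u) ^+ 2 / 2 + I y / lam.
  have : (1 - 8 * eps) * V <= (1 - 8 * eps) * Phi z u.
    by rewrite ler_wpM2l //; move: eps_le; lra.
  have : 8 * eps * (u ^+ 2 / 4 - coerc M) <= 8 * eps * Phi z u.
    by rewrite ler_pM2l //; move: eps_gt0; lra.
  have : eps * V <= eps * (M ^+ 2 / 2) by rewrite ler_pM2l.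
  have : 0 <= (M + minsize M + 2 + (minsize M + 1) ^+ 2) * eps.
    have M0 : 0 <= M by exact: le_trans zM.
    have := minsize_ge1 M; have := sqr_ge0 (minsize M + 1); set d := _ ^+ 2 => d0 M1.
    by rewrite mulr_ge0 ?(ltW eps_gt0) //; lra.
  move: h3; rewrite /errcst /energy; set p := F u; set i := I y / lam.
  set q := (M + minsize M + _ + _).
  set d := coerc M; set a := (z - u) ^+ 2; set b := u ^+ 2; set m := M ^+ 2.
  nra.
have : lam / 2 * (V - errcst M * eps + eps * u ^+ 2) <=
       lam / 2 * ((z - u) ^+ 2 / 2 + I y / lam).
  by rewrite ler_pM2l // divr_gt0.
have : 1 * u ^+ 2 <= lam * eps * u ^+ 2 by rewrite ler_wpM2r // sqr_ge0.
rewrite /u; set b := (y / mu) ^+ 2; set d := V - _; set e := (_ + I y / lam).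
by nra.
Qed.

(** The interval is taken to the left of the minimizer because the potential is
    nondecreasing: there it can only lower the energy, and only the quadratic term
    and the perturbation have to be estimated. *)
Lemma gibbs_ge M z u0 y : `|z| <= M -> is_min z u0 ->
  mu * (u0 - eps) <= y <= mu * u0 ->
  expR (- (lam / 2) * (Phi z u0 + errcst M * eps)) <= gibbs z y.
Proof.
move=> zM min_u0 /andP[yge yle]; rewrite ler_expR.
pose u := y / mu.
have uge : u0 - eps <= u by rewrite ler_pdivlMr // mulrC.
have ule : u <= u0 by rewrite ler_pdivrMr // mulrC.
have M0 : 0 <= M by exact: le_trans zM.
pose A := minsize M.
have A1 : 1 <= A := minsize_ge1 M.
have sq : u0 ^+ 2 <= A ^+ 2.
  have h1 := energy_coercive u0 zM.
  have h2 := min_u0 0; rewrite energy0r in h2; have h3 := sqr_norm_le zM.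
  have : u0 ^+ 2 <= A by rewrite /A /minsize; move: h1 h2 h3; lra.
  by move/le_trans; apply; rewrite expr2 ler_peMr // (le_trans ler01).
have nu0 : `|u0| <= A.
  by rewrite -(@ler_pXn2r _ 2) ?nnegrE // ?(le_trans ler01) // real_normK ?num_real.
have := zM; have := nu0; rewrite !ler_norml => /andP[u0A1 u0A2] /andP[zM1 zM2].
have e1 : eps <= 1 by move: eps_le; lra.
have := I_close y; rewrite -/u ler_norml => /andP[_ h3].
have h4 := potential_homo kappa_gt0 alpha_lt1 ule.
have h5 : (z - u) ^+ 2 <= (z - u0) ^+ 2 + eps * (2 * M + 2 * A + 1).
  have -> : (z - u) ^+ 2 = (z - u0) ^+ 2 + (u0 - u) * (2 * z - u - u0) by ring.
  rewrite lerD2l; have : 2 * z - u - u0 <= 2 * M + 2 * A + 1 by lra.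
  move=> /(ler_wpM2l (_ : 0 <= u0 - u)); rewrite subr_ge0 => /(_ ule)/le_trans; apply.
  by rewrite ler_wpM2r //; lra.
have h6 : u ^+ 2 <= (A + 1) ^+ 2 by apply: sqr_norm_le; rewrite ler_norml; lra.
rewrite !mulNr lerN2 ler_pM2l ?divr_gt0 //.
have h7 : eps * (1 + u ^+ 2) <= eps * (1 + (A + 1) ^+ 2) by rewrite ler_pM2l // lerD2l.
have h8 : 0 <= eps * (8 * (M ^+ 2 / 2 + coerc M) + 1).
  have := coerc_ge0 M; have := sqr_ge0 M; set d := M ^+ 2 => d0 M1.
  by rewrite mulr_ge0 ?(ltW eps_gt0) //; lra.
move: h3 h4 h5 h7 h8; rewrite /errcst -/A /energy -/u; set i := I y / lam.
set q := 8 * _ + 1; set a := (z - u) ^+ 2; set b := (z - u0) ^+ 2.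
set d := (A + 1) ^+ 2; set e := (u ^+ 2).
by lra.
Qed.

Lemma continuous_gibbs z : continuous (gibbs z).
Proof.
move=> y; apply: continuous_comp; last exact: continuous_expR.
apply: cvgMr; apply: cvgD; last by apply: cvgMl; exact: I_cont.
apply: cvgMl; rewrite expr2.
by apply: cvgM; (apply: cvgB; [exact: cvg_cst|apply: cvgMl]).
Qed.

Let gauss_mass : R := Num.sqrt (mu ^+ 2 * pi *+ 2).

Lemma integrable_gauss : leb.-integrable setT
  (EFin \o (fun y => expR (- (y - 0) ^+ 2 / (mu ^+ 2 *+ 2)))).
Proof.
have mu0 : mu != 0 by rewrite gt_eqF.
have m0 : 0 < gauss_mass.
  by rewrite sqrtr_gt0 pmulrn_lgt0 // mulr_gt0 ?pi_gt0 ?exprn_gt0.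
have := integrableZl measurableT gauss_mass (integrable_normal_pdf 0 mu).
apply: eq_integrable => // y _ /=; rewrite normal_pdfE // /normal_peak -EFinM.
by rewrite mulrA divff ?mul1r // gt_eqF.
Qed.

Lemma Rintegral_gauss :
  \int[leb]_y expR (- (y - 0) ^+ 2 / (mu ^+ 2 *+ 2)) = gauss_mass.
Proof.
have mu0 : mu != 0 by rewrite gt_eqF.
have m0 : 0 < gauss_mass.
  by rewrite sqrtr_gt0 pmulrn_lgt0 // mulr_gt0 ?pi_gt0 ?exprn_gt0.
have i1 := integrable_normal_pdf 0 mu.
have <- : \int[leb]_y (gauss_mass * normal_pdf 0 mu y) = gauss_mass.
  rewrite RintegralZl // /Rintegral.
  by have := integral_normal_pdf 0 mu; rewrite /= => ->; rewrite mulr1.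
apply: eq_Rintegral => y _; rewrite normal_pdfE // /normal_peak.
by rewrite mulrA divff ?mul1r // gt_eqF.
Qed.

Lemma measurable_gibbs z : measurable_fun setT (gibbs z).
Proof. by apply: continuous_measurable_fun => y; exact: continuous_gibbs. Qed.

Lemma integrable_gibbs z : leb.-integrable setT (EFin \o gibbs z).
Proof.
have zM : `|z| <= `|z| by [].
set M := `|z| in zM.
have leV u : - coerc M <= Phi z u.
  by have := energy_coercive u zM; have := sqr_ge0 u; set a := u ^+ 2; lra.
have Vle : - coerc M <= M ^+ 2 / 2.
  by have := coerc_ge0 M; have := sqr_ge0 M; set a := M ^+ 2; lra.
set B := expR (- (lam / 2) * (- coerc M - errcst M * eps)).
apply: (le_integrable measurableT _ _ (integrableZl measurableT B integrable_gauss)).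
  by apply/measurable_EFinP; exact: measurable_gibbs.
move=> y _ /=; rewrite lee_fin !ger0_norm ?mulr_ge0 ?expR_ge0 //.
exact: gibbs_le.
Qed.

Lemma gibbs_shift z h y : gibbs (z + h) y =
  gibbs z y * expR (- (lam / 2) * (h * (z - y / mu) + h ^+ 2 / 2)).
Proof. by rewrite -expRD; congr expR; field; rewrite !gt_eqF. Qed.

(** Two exponential tilts absorb the linear factor, [|x| <= exp x + exp (- x)], and a
    tilt of [gibbs z] is a multiple of [gibbs (z + h)]. *)
Lemma integrable_gibbs_mean z :
  leb.-integrable setT (EFin \o (fun y => (z - y / mu) * gibbs z y)).
Proof.
pose h := 2 / lam; pose B := expR (lam / 2 * (h ^+ 2 / 2)).
have i1 := integrableD measurableT (integrable_gibbs (z + h)) (integrable_gibbs (z - h)).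
apply: (le_integrable measurableT _ _ (integrableZl measurableT B i1)).
  apply/measurable_EFinP; apply: measurable_funM; last exact: measurable_gibbs.
  by apply: measurable_funB => //; apply: measurable_funM.
move=> y _ /=; rewrite lee_fin normrM [`|gibbs _ _|]ger0_norm ?expR_ge0 //.
rewrite [leRHS]ger0_norm ?mulr_ge0 ?addr_ge0 ?expR_ge0 //.
rewrite !gibbs_shift -mulrDr mulrCA mulrC ler_pM2l ?expR_gt0 //.
set x := z - y / mu.
rewrite mulrDr /B -!expRD.
have -> : lam / 2 * (h ^+ 2 / 2) + - (lam / 2) * (h * x + h ^+ 2 / 2) = - x.
  by rewrite /h; field; rewrite gt_eqF.
have -> : lam / 2 * (h ^+ 2 / 2) + - (lam / 2) * (- h * x + (- h) ^+ 2 / 2) = x.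
  by rewrite /h; field; rewrite gt_eqF.
have := expR_ge1Dx x; have := expR_ge1Dx (- x).
have := expR_gt0 x; have := expR_gt0 (- x).
by rewrite ler_norml; lra.
Qed.

Definition gibbs_mass z : R := \int[leb]_y gibbs z y.
Definition gibbs_mean z : R :=
  (\int[leb]_y ((z - y / mu) * gibbs z y)) / gibbs_mass z.

Lemma gibbs_mass_le M z V : `|z| <= M -> (forall u, V <= Phi z u) ->
  V <= M ^+ 2 / 2 ->
  gibbs_mass z <= expR (- (lam / 2) * (V - errcst M * eps)) * gauss_mass.
Proof.
move=> zM leV Vle; rewrite -Rintegral_gauss -RintegralZl //; last exact: integrable_gauss.
apply: le_Rintegral => //; first exact: integrable_gibbs.
- exact: (integrableZl measurableT _ integrable_gauss).
- by move=> y _; exact: gibbs_le.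
Qed.

Lemma gibbs_mass_ge M z u0 : `|z| <= M -> is_min z u0 ->
  expR (- (lam / 2) * (Phi z u0 + errcst M * eps)) * (mu * eps) <= gibbs_mass z.
Proof.
move=> zM min_u0; set B := expR _.
have i1 : leb.-integrable `[mu * (u0 - eps), mu * u0] (EFin \o gibbs z).
  by apply: integrableS (integrable_gibbs z).
have le1 : \int[leb]_(y in `[mu * (u0 - eps), mu * u0]) gibbs z y <= gibbs_mass z.
  rewrite Rintegral_mkcond; apply: le_Rintegral => //.
  - by rewrite -restrict_EFin; apply/(integrable_mkcond _ _).1.
  - exact: integrable_gibbs.
  - by move=> y _; rewrite patchE; case: ifP => // _; exact: expR_ge0.
apply: le_trans le1.
have -> : B * (mu * eps) = \int[leb]_(y in `[mu * (u0 - eps), mu * u0]) B.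
  rewrite Rintegral_cst //= lebesgue_measure_itv /= lte_fin ltr_pM2l //.
  by rewrite gtrBl eps_gt0 /=; congr (B * _); ring.
apply: le_Rintegral => //.
- apply: continuous_compact_integrable; first exact: segment_compact.
  by apply: continuous_subspaceT => x; exact: cvg_cst.
- by move=> y /=; rewrite in_itv /=; exact: gibbs_ge.
Qed.

(** Jensen's inequality for the exponential tilt that turns [gibbs z] into
    [gibbs (z + h)]: up to the quadratic term, the mean is a subgradient of the
    logarithm of the mass. It reduces to [1 + x <= exp x] with [x] centred at the mean. *)
Lemma gibbs_mass_tilt z h : 0 < gibbs_mass z ->
  gibbs_mass z * expR (- (lam / 2) * (h * gibbs_mean z + h ^+ 2 / 2)) <= gibbs_mass (z + h).
Proof.
move=> Z0; set m := gibbs_mean z; set s := - (lam / 2) * _.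
pose b := expR s; pose a := lam / 2 * h.
have i0 := integrable_gibbs z; have i1 := integrable_gibbs_mean z.
have Em : \int[leb]_y ((z - y / mu) * gibbs z y) = m * gibbs_mass z.
  by rewrite /m /gibbs_mean divfK // gt_eqF.
have iZ : leb.-integrable setT (EFin \o (fun y => b * (1 + a * m) * gibbs z y)).
  exact: (integrableZl measurableT _ i0).
have iM : leb.-integrable setT (EFin \o (fun y => b * a * ((z - y / mu) * gibbs z y))).
  exact: (integrableZl measurableT _ i1).
have -> : gibbs_mass z * b = \int[leb]_y (b * (1 + a * m) * gibbs z y -
    b * a * ((z - y / mu) * gibbs z y)).
  by rewrite RintegralB // !RintegralZl // Em -/(gibbs_mass z); ring.
apply: le_Rintegral => //.
- exact: (integrableB measurableT iZ iM).
- exact: integrable_gibbs.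
move=> y _; rewrite gibbs_shift.
have -> : - (lam / 2) * (h * (z - y / mu) + h ^+ 2 / 2) =
    s + - a * ((z - y / mu) - m) by rewrite /s /a; ring.
rewrite expRD -/b; set x := z - y / mu.
have -> : b * (1 + a * m) * gibbs z y - b * a * (x * gibbs z y) =
  gibbs z y * (b * (1 + - a * (x - m))) by ring.
by rewrite ler_pM2l ?expR_gt0 // ler_pM2l ?expR_gt0 // expR_ge1Dx.
Qed.

(** The Laplace principle in subgradient form. The two-sided estimate of the masses at
    [z] and [z + h] turns the tilt inequality into a comparison of minimal energies,
    and [u'] is a competitor at [z]. The polynomial prefactor [1 / eps] disappears
    because [lam] dominates [eps ^- 2]. *)
Lemma gibbs_mean_le M z h u u' : `|z| <= M -> `|z + h| <= M ->
  is_min z u -> is_min (z + h) u' ->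
  2 * Num.sqrt (pi *+ 2) <= lam * eps ^+ 2 ->
  h * (z - u' - gibbs_mean z) <= (2 * errcst M + 1) * eps.
Proof.
move=> zM zhM min_u min_u' lam_big.
set C := errcst M; set m := gibbs_mean z.
set V := Phi z u; set V' := Phi (z + h) u'.
have Zge := gibbs_mass_ge zM min_u.
have Z0 : 0 < gibbs_mass z.
  by apply: lt_le_trans Zge; rewrite mulr_gt0 ?expR_gt0 // mulr_gt0.
have V'le : V' <= M ^+ 2 / 2.
  apply: le_trans (min_u' 0) _; rewrite energy0r.
  by have := sqr_norm_le zhM; set a := _ ^+ 2; lra.
have Zle := gibbs_mass_le zhM min_u' V'le.
have := le_trans (gibbs_mass_tilt h Z0) Zle; rewrite -/m => T1.
have := le_trans (ler_wpM2r (expR_ge0 _) Zge) T1.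
rewrite -/C -/V -/V' mulrAC -expRD => T2.
have gm : gauss_mass = mu * Num.sqrt (pi *+ 2).
  by rewrite /gauss_mass -mulrnAr sqrtrM ?sqr_ge0 // sqrtr_sqr gtr0_norm.
(* half of lam * X is the exponent left after dividing both masses *)
pose X := V' - V - h * m - h ^+ 2 / 2 - 2 * C * eps.
pose P := expR (- (lam / 2) * (V' - C * eps)).
have T3 : expR (lam / 2 * X) * eps <= Num.sqrt (pi *+ 2).
  have P0 : 0 < P * mu by rewrite mulr_gt0 ?expR_gt0.
  rewrite -(ler_pM2l P0) -[leRHS]mulrA -gm; apply: le_trans T2.
  suff -> : expR (- (lam / 2) * (V + C * eps) + - (lam / 2) * (h * m + h ^+ 2 / 2)) =
      P * expR (lam / 2 * X).
    by rewrite le_eqVlt; apply/orP; left; apply/eqP; ring.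
  by rewrite -expRD; congr expR; rewrite /X; field.
have T4 : X <= eps.
  rewrite leNgt; apply/negP => Xe.
  have := expR_ge1Dx (lam / 2 * X) => T5.
  have : (1 + lam / 2 * X) * eps <= Num.sqrt (pi *+ 2).
    by apply: le_trans T3; rewrite ler_pM2r.
  have : lam / 2 * eps * eps < lam / 2 * X * eps.
    by rewrite ltr_pM2r // ltr_pM2l // divr_gt0.
  move: (eps_gt0) lam_big; rewrite expr2; clear -X.
  by set S := Num.sqrt _; clearbody X S; nra.
have := min_u u'; rewrite -/V => VV.
have e : V' = Phi z u' + h * (z - u') + h ^+ 2 / 2 by rewrite -energy_shift.
have : h * (z - u' - m) = h * (z - u') - h * m by ring.
by move: T4; rewrite /X e; lra.
Qed.

End laplace.

(** * The primitive of the initial datum *)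

Section primitive.
Context {R : realType}.
Local Notation leb := (@lebesgue_measure R).
Implicit Types f : R -> R.

Lemma integrable_itv_continuous f (a b : R) : continuous f ->
  leb.-integrable `[a, b] (EFin \o f).
Proof.
move=> cf; apply: continuous_compact_integrable; first exact: segment_compact.
exact: continuous_subspaceT.
Qed.

(** The two oriented cases of [int0] are one integral from a fixed lower bound [a],
    up to a constant, which makes the fundamental theorem of calculus applicable. *)
Lemma int0E f (a x : R) : continuous f -> a < 0 -> a < x ->
  int0 f x = \int[leb]_(z in `[a, x]) f z - \int[leb]_(z in `[a, 0]) f z.
Proof.
move=> cf a0 ax; rewrite /int0; case: leP => [x0|x0].
  rewrite (@Rintegral_itvB _ _ _ _ 0) ?bnd_simp ?(ltW a0) //; last exact: integrable_itv_continuous.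
  rewrite Rintegral_itv_obnd_cbnd //.
  apply: integrableS (@integrable_itv_continuous f 0 x cf) => //.
  exact: subset_itv_oc_cc.
rewrite -[RHS]opprB; congr (- _).
rewrite (@Rintegral_itvB _ _ _ _ x) ?bnd_simp ?(ltW ax) ?(ltW x0) //; last exact: integrable_itv_continuous.
rewrite Rintegral_itv_obnd_cbnd //.
apply: integrableS (@integrable_itv_continuous f x 0 cf) => //.
exact: subset_itv_oc_cc.
Qed.

Lemma is_derive_int0 f (y : R) : continuous f -> is_derive y 1 (int0 f) (f y).
Proof.
move=> cf; pose a := - (`|y| + 1).
have a0 : a < 0 by rewrite oppr_lt0 ltr_wpDl.
have ay : a < y by have := ler_norm (- y); rewrite normrN /a; lra.
have [|dJ J'] := @continuous_FTC1_closed R f a y (y + 1) _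
  (@integrable_itv_continuous f a (y + 1) cf) ay (cf y).
  by rewrite ltrDl.
have d1 : is_derive y 1 (fun x => \int[leb]_(z in `[a, x]) f z) (f y).
  by split => //; rewrite -derive1E.
have d2 := is_deriveB d1 (is_derive_cst (\int[leb]_(z in `[a, 0]) f z) y 1).
rewrite subr0 in d2; apply: near_eq_is_derive d2.
near=> x; rewrite (int0E cf a0) //.
by near: x; exact: lt_nbhsr.
Unshelve. all: by end_near. Qed.

Lemma continuous_int0 f : continuous f -> continuous (int0 f).
Proof.
move=> cf y; apply/differentiable_continuous/derivable1_diffP.
by case: (is_derive_int0 y cf).
Qed.

(** The mean value inequality for a majorant [P] of variable slope: it integrates a
    pointwise bound without mentioning integrals. *)
Lemma derive_dominated (A a P p : R -> R) (X x : R) :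
  (forall y, X <= y -> is_derive y 1 A (a y)) ->
  (forall y, X <= y -> is_derive y 1 P (p y)) ->
  (forall y, X <= y -> `|a y| <= p y) -> X <= x ->
  `|A x - A X| <= P x - P X.
Proof.
move=> dA dP ap Xx.
have mono (B b : R -> R) : (forall y, X <= y -> is_derive y 1 B (b y)) ->
    (forall y, X <= y -> 0 <= b y) -> B X <= B x.
  move=> dB b0.
  have [||c cX e] := @MVT_segment R B b X x Xx.
  - by move=> y; rewrite in_itv/= => /andP[/ltW Xy _]; exact: dB.
  - apply: continuous_in_subspaceT => y; rewrite inE/= in_itv/= => /andP[Xy _].
    by apply/differentiable_continuous/derivable1_diffP; case: (dB y Xy).
  - rewrite -subr_ge0 e mulr_ge0 ?subr_ge0 // b0 //.
    by move: cX; rewrite in_itv/= => /andP[].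
have h1 : (P - A) X <= (P - A) x.
  apply: (mono _ (fun y => p y - a y)) => y Xy.
    by apply: is_deriveB; [exact: dP|exact: dA].
  by rewrite subr_ge0 (le_trans (ler_norm _)) ?ap.
have h2 : (P + A) X <= (P + A) x.
  apply: (mono _ (fun y => p y + a y)) => y Xy.
    by apply: is_deriveD; [exact: dP|exact: dA].
  by have := ap y Xy; rewrite ler_norml; lra.
by move: h1 h2; rewrite !fctE ler_norml; lra.
Qed.

End primitive.

Section growth.
Context {R : realType}.
Variables kappa alpha : R.
Hypotheses (kappa_gt0 : 0 < kappa) (alpha_gt0 : 0 < alpha) (alpha_lt1 : alpha < 1).
Local Notation F := (potential kappa alpha).
Local Notation c := (kappa / (1 - alpha)).
Local Notation eta := ((1 - alpha) / 2).
Variables (f L : R -> R).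
Hypothesis f_cont : continuous f.
Hypothesis L_ge0 : forall mu, 1 <= mu -> 0 <= L mu.
Hypothesis f_tail : forall e : R, 0 < e -> exists X : R, forall s y mu : R, s = 1 \/ s = -1 ->
  X <= y -> X <= mu ->
  `|L mu * f (s * y) - kappa / y `^ alpha| <=
    e / y `^ alpha * expR (eta * `|ln mu - ln y|).
Hypothesis L_small : forall e : R, 0 < e -> exists X : R, forall mu : R,
  X <= mu -> L mu <= e * mu `^ (1 - alpha).

Let eta_gt0 : 0 < eta. Proof. by rewrite divr_gt0 // subr_gt0. Qed.

Let powE (a y : R) : 0 < y -> y `^ a = expR (a * ln y).
Proof. by move=> y0; rewrite /powR gt_eqF. Qed.

(** A primitive of [y |-> y ^ -alpha ((y / mu) ^ eta + (mu / y) ^ eta)], which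
    dominates the error allowed by [f_tail]. With [eta = (1 - alpha) / 2] both
    exponents stay integrable at 0 and below 2 after integration. *)
Definition majorant mu y : R :=
  (3 * eta)^-1 * (mu `^ (- eta) * y `^ (3 * eta)) + eta^-1 * (mu `^ eta * y `^ eta).

Implicit Types mu x y e : R.

Lemma is_derive_majorant mu y : 0 < mu -> 0 < y ->
  is_derive y 1 (majorant mu)
    ((y `^ alpha)^-1 * (expR (eta * (ln mu - ln y)) + expR (- (eta * (ln mu - ln y))))).
Proof.
move=> mu0 y0.
have d1 := is_deriveZ ((3 * eta)^-1 * mu `^ (- eta)) (is_derive1_powR (3 * eta) y0).
have d2 := is_deriveZ (eta^-1 * mu `^ eta) (is_derive1_powR eta y0).
have d3 := is_deriveD d1 d2.
have -> : majorant mu = ((3 * eta)^-1 * mu `^ (- eta)) \*: (@powR R ^~ (3 * eta)) +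
    (eta^-1 * mu `^ eta) \*: (@powR R ^~ eta).
  by apply/funext => x; rewrite fctE /= /majorant /GRing.scale /= !mulrA.
apply: (is_derive_eq d3); rewrite /GRing.scale /=.
have e0 : eta != 0 by rewrite gt_eqF.
have -> : (3 * eta)^-1 * mu `^ (- eta) * (3 * eta * y `^ (3 * eta - 1)) =
    mu `^ (- eta) * y `^ (3 * eta - 1).
  by field; move: e0; rewrite mulf_eq0 negb_or => /andP[].
have -> : eta^-1 * mu `^ eta * (eta * y `^ (eta - 1)) = mu `^ eta * y `^ (eta - 1).
  by field; move: e0; rewrite mulf_eq0 negb_or => /andP[].
rewrite -powRN !powE // mulrDr -!expRD addrC.
by congr (expR _ + expR _); field.
Qed.

Lemma majorant_le mu y : 0 < mu -> 0 <= y ->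
  majorant mu y <= 2 / eta * (mu `^ (1 - alpha) * (1 + (y / mu) ^+ 2)).
Proof.
move=> mu0 y0; pose s := y / mu.
have s0 : 0 <= s by rewrite divr_ge0 // ltW.
have ye : y = s * mu by rewrite /s divfK // gt_eqF.
have small p : 0 <= p -> p <= 2 -> s `^ p <= 1 + s ^+ 2.
  move=> p0 p2; have [s1|s1] := leP 1 s.
    apply: le_trans (ler_powR s1 p2) _.
    by rewrite -(powR_mulrn 2 s0) lerDr.
  have := ge0_ler_powR p0 (_ : s \is Num.nneg) (_ : 1 \is Num.nneg) (ltW s1).
  by rewrite !nnegrE s0 ler01 powR1 => /(_ isT isT)/le_trans; apply; rewrite lerDl sqr_ge0.
have e1 : eta <= 1 / 2 by move: alpha_gt0; lra.
have h1 : s `^ (3 * eta) <= 1 + s ^+ 2 by apply: small; move: e1 eta_gt0; lra.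
have h2 : s `^ eta <= 1 + s ^+ 2 by apply: small; move: e1 eta_gt0; lra.
have mue : mu `^ (1 - alpha) = mu `^ eta * mu `^ eta.
  by rewrite !powE // -expRD; congr expR; field.
have -> : majorant mu y = mu `^ (1 - alpha) *
    ((3 * eta)^-1 * s `^ (3 * eta) + eta^-1 * s `^ eta).
  rewrite /majorant ye !(powRM _ s0 (ltW mu0)) mue.
  have -> : mu `^ (3 * eta) = mu `^ eta * mu `^ eta * mu `^ eta.
    by rewrite !powE // -!expRD; congr expR; field.
  have -> : mu `^ (- eta) = (mu `^ eta)^-1 by rewrite powRN.
  have : mu `^ eta != 0 by rewrite gt_eqF // powR_gt0.
  set m := mu `^ eta; set a := (3 * eta)^-1; set b := eta^-1.
  move=> m0; by field.
have m0 : 0 < mu `^ (1 - alpha) by rewrite powR_gt0.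
rewrite [leRHS]mulrCA ler_pM2l //.
have i0 : 0 < eta^-1 by rewrite invr_gt0.
have -> : (3 * eta)^-1 = 3^-1 * eta^-1 by rewrite invfM.
move: h1 h2; rewrite -/s; set a := s `^ _; set b := s `^ _; set d := 1 + _ => h1 h2.
have : eta^-1 * a <= eta^-1 * d by rewrite ler_pM2l.
have : eta^-1 * b <= eta^-1 * d by rewrite ler_pM2l.
have : 0 <= eta^-1 * d by rewrite mulr_ge0 ?(ltW i0) // addr_ge0 // sqr_ge0.
by lra.
Qed.

Lemma powR_large a K : 0 < a -> exists X : R, forall mu, X <= mu -> K <= mu `^ a.
Proof.
move=> a0; pose k := Num.max 1 K; have k0 : 0 < k by rewrite lt_max ltr01.
exists (k `^ a^-1) => mu Xmu.
have h := ge0_ler_powR (ltW a0) (_ : k `^ a^-1 \is Num.nneg) (_ : mu \is Num.nneg) Xmu.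
move: h; rewrite !nnegrE powR_ge0 (le_trans (powR_ge0 _ _) Xmu) => /(_ isT isT).
rewrite -powRrM mulVf ?gt_eqF // powRr1 ?(ltW k0) // => /(le_trans _); apply.
by rewrite le_max lexx orbT.
Qed.

Lemma int0_bounded X : exists B : R, forall x, `|x| <= X -> `|int0 f x| <= B.
Proof.
have cI := continuous_int0 f_cont.
have : compact (int0 f @` `[- X, X]).
  by apply: continuous_compact; [exact: continuous_subspaceT|exact: segment_compact].
move=> /compact_bounded[B [_ hB]]; exists (B + 1) => x xX.
apply: (hB (B + 1)); first by rewrite ltrDl.
by exists x => //=; rewrite in_itv /= -ler_norml.
Qed.

(** A Karamata-type estimate: the rescaled primitive of [f] converges to the
    potential, with an error that grows at most quadratically. Up to a fixed [X1]
    everything is bounded and [mu ^ (1 - alpha)] wins; beyond [X1] the derivative of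
    the difference is dominated by that of [majorant]. *)
Lemma int0_asymptotics e : 0 < e -> exists X : R, forall mu x, X <= mu ->
  `|L mu * int0 f x - F x| <= e * (mu `^ (1 - alpha) * (1 + (x / mu) ^+ 2)).
Proof.
move=> e0; pose e1 := e * eta / 4.
have e1_gt0 : 0 < e1 by rewrite /e1 divr_gt0 // mulr_gt0.
have [X0 hX0] := f_tail e1_gt0.
pose X1 := Num.max 1 X0.
have X1_ge1 : 1 <= X1 by rewrite le_max lexx.
have X1_gt0 : 0 < X1 := lt_le_trans ltr01 X1_ge1.
have [B hB] := int0_bounded X1.
pose B1 := Num.max 1 B; have B1_gt0 : 0 < B1 by rewrite lt_max ltr01.
have [X2 hX2] := @L_small (e / 4 / B1) (ltac:(by rewrite !divr_gt0)).
have [X3 hX3] := @powR_large (1 - alpha) (c * (1 + X1) * 4 / e) (ltac:(by rewrite subr_gt0)).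
exists (Num.max X1 (Num.max X2 X3)) => mu x.
rewrite !ge_max => /andP[/andP[mu1 X0mu] /andP[X2mu X3mu]].
have mu0 : 0 < mu := lt_le_trans ltr01 mu1.
set m := mu `^ (1 - alpha); have m0 : 0 < m by rewrite powR_gt0.
have near0 y : `|y| <= X1 -> `|L mu * int0 f y - F y| <= e / 2 * m.
  move=> yX; apply: le_trans (ler_normB _ _) _; rewrite normrM (ger0_norm (L_ge0 mu1)).
  have h1 : L mu * `|int0 f y| <= e / 4 * m.
    have := ler_pM (L_ge0 mu1) (normr_ge0 _) (hX2 _ X2mu) (_ : `|int0 f y| <= B1).
    rewrite le_max (hB _ yX) orbT => /(_ isT)/le_trans; apply.
    by rewrite mulrAC divfK // gt_eqF.
  have h2 : `|F y| <= e / 4 * m.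
    apply: le_trans (norm_potential_le kappa_gt0 alpha_gt0 alpha_lt1 y) _.
    have c0 : 0 < c by rewrite divr_gt0 // subr_gt0.
    have : c * (1 + `|y|) <= c * (1 + X1) by rewrite ler_pM2l // lerD2l.
    move=> /le_trans; apply; have := hX3 _ X3mu; rewrite -/m ler_pdivrMr // => h.
    by move: h; set d := c * _; lra.
  by lra.
have sq0 : 0 <= (x / mu) ^+ 2 by rewrite sqr_ge0.
have em0 : 0 < e * m by rewrite mulr_gt0.
have [xX|Xx] := leP `|x| X1.
  apply: le_trans (near0 _ xX) _.
  rewrite mulrA; have : 0 <= e * m * (x / mu) ^+ 2 by rewrite mulr_ge0 // ltW.
  by set d := (_ ^+ 2); lra.
(* both half-lines at once: s is the sign of x *)
have tail (s y : R) : s = 1 \/ s = -1 -> X1 <= y ->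
    `|L mu * (s * int0 f (s * y)) - F y| <= e * (m * (1 + (y / mu) ^+ 2)).
  move=> hs X1y; have y0 := lt_le_trans X1_gt0 X1y.
  have ss : s * s = 1 by case: hs => ->; ring.
  pose D (w : R) := L mu * (s * int0 f (s * w)) - F w.
  have dD w : X1 <= w -> is_derive w 1 D (L mu * f (s * w) - kappa / w `^ alpha).
    move=> Xw; have w0 := lt_le_trans X1_gt0 Xw.
    have d1 := is_deriveZ s (is_derive_id w 1).
    have d2 := @is_derive1_comp R _ _ w _ _ (is_derive_int0 (s *: w) f_cont) d1.
    have d3 := is_deriveZ (L mu) (is_deriveZ s d2).
    have d4 := is_deriveB d3 (is_derive_potential kappa alpha_lt1 (lt0r_neq0 w0)).
    have -> : D = L mu \*: (s \*: (int0 f \o (s \*: id))) - F by [].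
    apply: (is_derive_eq d4); rewrite /GRing.scale /= (gtr0_norm w0).
    have -> : s * (f (s * w) * (s * 1)) = (s * s) * f (s * w) by ring.
    by rewrite ss mul1r.
  have dP w : X1 <= w -> is_derive w 1 (e1 \*: majorant mu) (e1 *: ((w `^ alpha)^-1 *
      (expR (eta * (ln mu - ln w)) + expR (- (eta * (ln mu - ln w)))))).
    by move=> Xw; apply: is_deriveZ; apply: is_derive_majorant => //; exact: lt_le_trans Xw.
  have dom w : X1 <= w -> `|L mu * f (s * w) - kappa / w `^ alpha| <=
      e1 *: ((w `^ alpha)^-1 *
        (expR (eta * (ln mu - ln w)) + expR (- (eta * (ln mu - ln w))))).
    rewrite ge_max => /andP[w1 Xw]; apply: le_trans (hX0 _ _ _ hs Xw X0mu) _.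
    have w0 := lt_le_trans ltr01 w1.
    rewrite /GRing.scale /= -mulrA ler_pM2l // ler_pM2l ?invr_gt0 ?powR_gt0 //.
    have [h|h] := leP 0 (ln mu - ln w); first by rewrite (ger0_norm h) lerDl expR_ge0.
    by rewrite (ltr0_norm h) mulrN lerDr expR_ge0.
  have DX : `|D X1| <= e / 2 * m.
    have sX : `|s * X1| <= X1.
      by rewrite normrM (gtr0_norm X1_gt0); case: hs => ->; rewrite ?normrN normr1 mul1r.
    apply: le_trans (near0 _ sX); rewrite /D le_eqVlt; apply/orP; left; apply/eqP.
    case: hs => ->; first by rewrite !mul1r.
    by rewrite !mulN1r potentialN -[RHS]normrN; congr `|_|; ring.
  have := derive_dominated dD dP dom X1y; rewrite /GRing.scale /= -/(D y) => h1.
  have h2 : 0 <= majorant mu X1.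
    apply: addr_ge0; (apply: mulr_ge0; last by rewrite mulr_ge0 ?powR_ge0);
      by rewrite invr_ge0; move: eta_gt0; lra.
  have h3 := majorant_le mu0 (ltW y0).
  have h4 : e1 * majorant mu y <= e / 2 * (m * (1 + (y / mu) ^+ 2)).
    have -> : e / 2 * (m * (1 + (y / mu) ^+ 2)) =
        e1 * (2 / eta * (m * (1 + (y / mu) ^+ 2))).
      by rewrite /e1; field; rewrite !gt_eqF //; move: eta_gt0; lra.
    by rewrite ler_pM2l.
  have h5 : 0 <= e1 * majorant mu X1 by rewrite mulr_ge0 // ltW.
  have h6 := ler_normD (D y - D X1) (D X1); rewrite subrK in h6.
  have h7 : 0 <= e * m * (y / mu) ^+ 2 by rewrite mulr_ge0 ?sqr_ge0 // ltW.
  apply: le_trans h6 _; have scaleE w : e1 *: majorant mu w = e1 * majorant mu w by [].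
  move: h1 DX h4 h5 h7; rewrite !scaleE.
  by set d := (_ ^+ 2); set A := `|_|; set A' := `|D X1|; lra.
have [x0|x0] := leP 0 x.
  have := tail 1 x (or_introl erefl); rewrite !mul1r; apply.
  by rewrite -(ger0_norm x0) ltW.
have := tail (-1) (- x) (or_intror erefl).
rewrite !mulN1r opprK potentialN mulrN -opprD normrN mulNr sqrrN; apply.
by rewrite -(ltr0_norm x0) ltW.
Qed.

End growth.

(** * Rescaled solutions *)

Section core.
Context {R : realType}.
Variables kappa alpha : R.
Hypotheses (kappa_gt0 : 0 < kappa) (alpha_gt0 : 0 < alpha) (alpha_lt1 : alpha < 1).
Local Notation F := (potential kappa alpha).
Variables (f L : R -> R).
Hypothesis f_cont : continuous f.
Hypothesis L_ge0 : forall mu, 1 <= mu -> 0 <= L mu.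
Hypothesis L_gt0 : forall mu, 1 < mu -> 0 < L mu.
Hypothesis f_tail : forall e : R, 0 < e -> exists X : R, forall s y mu : R,
  s = 1 \/ s = -1 -> X <= y -> X <= mu ->
  `|L mu * f (s * y) - kappa / y `^ alpha| <=
    e / y `^ alpha * expR ((1 - alpha) / 2 * `|ln mu - ln y|).
Hypothesis L_small : forall e : R, 0 < e -> exists X : R, forall mu : R,
  X <= mu -> L mu <= e * mu `^ (1 - alpha).
Implicit Types mu t z x y : R.

Lemma potential_scale mu x : 0 < mu -> F (x / mu) = F x / mu `^ (1 - alpha).
Proof.
move=> mu0; have m0 : 0 < mu^-1 by rewrite invr_gt0.
rewrite /potential sgrM (gtr0_sg m0) mulr1 normrM (gtr0_norm m0).
rewrite powRM ?normr_ge0 ?(ltW m0) // -!mulrA; congr (_ * (_ * (_ * (_ * _)))).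
by rewrite powRV // ltW.
Qed.

(** The exponents agree once [mu ^+ 2 / t] is the large parameter, and the factor
    [mu / t] of [(z * mu - y) / t = (mu / t) * (z - y / mu)] cancels [t / mu]. *)
Lemma burgers_gibbs_mean mu t z : 0 < mu -> 0 < t ->
  (@lebesgue_measure R).-integrable setT
    (EFin \o (fun y => (z - y / mu) * gibbs (int0 f) (mu ^+ 2 / t) mu z y)) ->
  t / mu * burgers_solution f (z * mu) t = gibbs_mean (int0 f) (mu ^+ 2 / t) mu z.
Proof.
move=> mu0 t0 ig.
have we : hopf_cole_weight f (z * mu) t = gibbs (int0 f) (mu ^+ 2 / t) mu z.
  apply/funext => y; rewrite /hopf_cole_weight /gibbs; congr expR; field.
  by rewrite !gt_eqF.
rewrite /burgers_solution /gibbs_mean /gibbs_mass we.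
have -> : \int[@lebesgue_measure R]_y ((z * mu - y) / t * gibbs (int0 f) (mu ^+ 2 / t) mu z y) =
    mu / t * \int[@lebesgue_measure R]_y ((z - y / mu) * gibbs (int0 f) (mu ^+ 2 / t) mu z y).
  rewrite -RintegralZl //; apply: eq_Rintegral => y _.
  by rewrite mulrA; congr (_ * _); field; rewrite !gt_eqF.
rewrite !mulrA; congr (_ / _).
have -> : t / mu * mu / t = 1 by field; rewrite !gt_eqF.
by rewrite mul1r.
Qed.

Variables (zc : R).
Hypothesis zc_gt : gfun kappa alpha (y0 kappa alpha) < zc.
Hypothesis zc_min : forall z, z != zc -> global_min kappa alpha z (ustar kappa alpha zc z).

Local Notation u_ := (ustar kappa alpha zc).

(** The Laplace principle with steps [h] and [- h] squeezes the rescaled solution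
    between [z - u_ (z + h)] and [z - u_ (z - h)] up to an error [C * eps / h]. The
    branch is Lipschitz on the side of [zc] that contains [z], so [h] is fixed first
    and [eps] afterwards, uniformly in [z]. *)
Lemma burgers_profile M d tau : 0 < d -> 0 < tau -> exists X : R, forall mu z,
  X <= mu -> `|z| <= M -> d <= `|z - zc| ->
  `|(mu `^ (1 + alpha) * L mu) / mu * burgers_solution f (z * mu) (mu `^ (1 + alpha) * L mu)
    - (z - u_ z)| <= tau.
Proof.
move=> d0 tau0.
have [K K0 lip] := ustar_lipschitz kappa_gt0 alpha_gt0 zc_gt.
pose h := Num.min (Num.min (d / 2) 1) (tau / (2 * K)).
have h0 : 0 < h by rewrite !lt_min ltr01 !divr_gt0 // mulr_gt0.
have hd : h <= d / 2 by rewrite !ge_min lexx.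
have h1 : h <= 1 by rewrite !ge_min lexx orbT.
have hK : K * h <= tau / 2.
  rewrite -ler_pdivlMl // (_ : K^-1 * _ = tau / (2 * K)) ?ge_min ?lexx ?orbT //.
  by field; rewrite gt_eqF.
pose C := 2 * errcst kappa alpha (M + 1) + 1; pose C1 := Num.max 1 C.
have C10 : 0 < C1 by rewrite lt_max ltr01.
pose eps := Num.min 8^-1 (h * tau / (2 * C1)).
have eps0 : 0 < eps by rewrite lt_min invr_gt0 ltr0n divr_gt0 // mulr_gt0.
have eps8 : eps <= 8^-1 by rewrite ge_min lexx.
have Ceps : C * eps <= h * tau / 2.
  have : C * eps <= C1 * eps by rewrite ler_pM2r // le_max lexx orbT.
  move=> /le_trans; apply; rewrite -ler_pdivlMl //.
  rewrite (_ : C1^-1 * _ = h * tau / (2 * C1)) ?ge_min ?lexx ?orbT //.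
  by field; rewrite gt_eqF.
pose S := Num.sqrt (pi *+ 2 : R); have S0 : 0 <= S := sqrtr_ge0 _.
(* Lam is large enough for both requirements of the Laplace principle *)
pose Lam := eps^-1 + 2 * S / eps ^+ 2.
have Lam0 : 0 < Lam by rewrite ltr_wpDr ?invr_gt0 // !mulr_ge0 // ?invr_ge0 ?sqr_ge0.
have [X1 hX1] := int0_asymptotics kappa_gt0 alpha_gt0 alpha_lt1 f_cont L_ge0 f_tail L_small eps0.
have [X2 hX2] := @L_small Lam^-1 (ltac:(by rewrite invr_gt0)).
exists (Num.max (Num.max 2 X1) X2) => mu z.
rewrite !ge_max => /andP[/andP[mu2 X1mu] X2mu] zM zd.
have mu1 : 1 < mu by apply: lt_le_trans mu2; rewrite ltr1n.
have mu0 : 0 < mu := lt_trans ltr01 mu1.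
have Lmu := L_gt0 mu1; set t := _ * L mu.
have t0 : 0 < t by rewrite mulr_gt0 ?powR_gt0.
pose m := mu `^ (1 - alpha); have m0 : 0 < m by rewrite powR_gt0.
pose lam := mu ^+ 2 / t.
have lamE : lam = m / L mu.
  rewrite /lam /m /t invfM mulrA; congr (_ / _).
  apply: (mulIf (lt0r_neq0 (powR_gt0 (1 + alpha) mu0))).
  rewrite divfK ?gt_eqF ?powR_gt0 // -powRD ?(gt_eqF mu0) ?implybT //.
  by rewrite -powR_mulrn ?(ltW mu0) //; congr (_ `^ _); ring.
have lam0 : 0 < lam by rewrite lamE divr_gt0.
have lamLam : Lam <= lam.
  by rewrite lamE ler_pdivlMr // -ler_pdivlMl // mulrC -/m; rewrite mulrC; exact: hX2.
have lam_eps : 1 <= lam * eps.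
  rewrite -ler_pdivrMr // mul1r (le_trans _ lamLam) // lerDl.
  by rewrite !mulr_ge0 // invr_ge0 sqr_ge0.
have lam_big : 2 * S <= lam * eps ^+ 2.
  rewrite -ler_pdivrMr ?exprn_gt0 // (le_trans _ lamLam) // lerDr.
  by rewrite invr_ge0 ltW.
have close y : `|int0 f y / lam - potential kappa alpha (y / mu)| <= eps * (1 + (y / mu) ^+ 2).
  rewrite potential_scale // -/m -(ler_pM2r m0) -[X in _ * X](gtr0_norm m0) -normrM.
  rewrite mulrBl divfK ?gt_eqF // lamE invf_div.
  rewrite mulrA divfK ?gt_eqF // [_ * L mu]mulrC -mulrA [_ * m]mulrC.
  exact: hX1.
have cI := continuous_int0 f_cont.
have mean_le := gibbs_mean_le kappa_gt0 alpha_gt0 alpha_lt1 cI lam0 mu0 eps0 eps8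
  lam_eps close _ _ _ _ lam_big.
rewrite burgers_gibbs_mean //; last first.
  exact: (integrable_gibbs_mean kappa_gt0 alpha_gt0 alpha_lt1 cI lam0 mu0 eps0 eps8 lam_eps close).
rewrite -/lam; set mean := gibbs_mean _ _ _ _.
have nz k : `|k| <= h -> z + k != zc /\ `|z + k| <= M + 1.
  move=> kh; split.
    apply/eqP => e; move: zd; rewrite leNgt => /negP; apply.
    have -> : z - zc = - k by rewrite -e; ring.
    by rewrite normrN (le_lt_trans kh) // (le_lt_trans hd) // ltr_pdivrMr // ltr_pMr // ltr1n.
  by rewrite (le_trans (ler_normD _ _)) // lerD // (le_trans kh).
have [z_zc zM1] := nz 0 (ltac:(by rewrite normr0 ltW)); rewrite addr0 in z_zc zM1.
have nh : `|h| <= h by rewrite gtr0_norm.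
have nNh : `|- h| <= h by rewrite normrN gtr0_norm.
have [zh zhM] := nz h nh; have [zNh zNhM] := nz (- h) nNh.
have up := mean_le _ _ _ _ _ zM1 zhM (zc_min z_zc) (zc_min zh).
have dn := mean_le _ _ _ _ _ zM1 zNhM (zc_min z_zc) (zc_min zNh).
have h2d : h < d by rewrite (le_lt_trans hd) // ltr_pdivrMr // ltr_pMr // ltr1n.
have sides : same_side zc z (z + h) /\ same_side zc (z - h) z.
  move: zd; rewrite /same_side; have [zz|zz] := leP zc z.
    rewrite ger0_norm ?subr_ge0 // => zd.
    by split; apply/orP; left; apply/andP; split; lra.
  rewrite ltr0_norm ?subr_lt0 // => zd.
  by split; apply/orP; right; apply/andP; split; lra.
have l1 := lip _ _ sides.1 (ltac:(by rewrite ltrDl)).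
have l2 := lip _ _ sides.2 (ltac:(by rewrite gtrBl)).
rewrite addrAC subrr add0r in l1.
rewrite opprB addrCA subrr addr0 in l2.
rewrite -/mean -/C in up dn.
have up' : h * (z - u_ (z + h) - mean) <= h * (tau / 2) by rewrite mulrA (le_trans up).
have dn' : h * - (z - u_ (z - h) - mean) <= h * (tau / 2).
  by rewrite mulrN -mulNr mulrA (le_trans dn).
rewrite !ler_pM2l // in up' dn'.
by rewrite ler_norml; lra.
Qed.

End core.

(** * Tails of the initial data *)

Section tails.
Context {R : realType}.
Variables kappa alpha beta : R.
Hypotheses (kappa_gt0 : 0 < kappa) (alpha_gt0 : 0 < alpha) (alpha_lt1 : alpha < 1).
Hypotheses (beta_gt0 : 0 < beta).
Local Notation eta := ((1 - alpha) / 2).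
Implicit Types (f h : R -> R) (e x y s mu t : R).

Let eta_gt0 : 0 < eta. Proof. by rewrite divr_gt0 // subr_gt0. Qed.

Lemma equiv_tail f h e : equiv_pm_infty f h -> 0 < e ->
  exists X : R, forall s y, s = 1 \/ s = -1 -> X <= y ->
    exists2 w, `|w| <= e & f (s * y) = h (s * y) * (1 + w).
Proof.
move=> [ w0 [wP wN fP fN]] e0.
have [X1 [_ hX1]] : \forall y \near +oo, `|w0 y| <= e /\ f y = h y * (1 + w0 y).
  by near=> y; split; near: y => //; exact: ((cvgr0Pnorm_le _).1 wP).
have [X2 [_ hX2]] : \forall y \near -oo, `|w0 y| <= e /\ f y = h y * (1 + w0 y).
  by near=> y; split; near: y => //; exact: ((cvgr0Pnorm_le _).1 wN).
exists (Num.max X1 (- X2) + 1) => s y hs; set X := Num.max _ _ => Xy.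
have /andP[h1 h2] : (X1 < y) && (- X2 < y).
  by rewrite -gt_max -/X (lt_le_trans _ Xy) // ltrDl.
exists (w0 (s * y)); case: hs => ->; rewrite ?mul1r ?mulN1r.
- by have [] := hX1 _ h1.
- by have [] := hX2 (- y) (ltac:(by rewrite ltrNl)).
- by have [] := hX1 _ h1.
- by have [] := hX2 (- y) (ltac:(by rewrite ltrNl)).
Unshelve. all: by end_near. Qed.

(** The factor 1 is the slowly varying function of data without logarithm. *)
Lemma power_tail f e : equiv_pm_infty f (fun y => kappa / `|y| `^ alpha) -> 0 < e ->
  exists X : R, forall s y mu, s = 1 \/ s = -1 -> X <= y -> X <= mu ->
  `|1 * f (s * y) - kappa / y `^ alpha| <=
    e / y `^ alpha * expR (eta * `|ln mu - ln y|).
Proof.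
move=> hf e0; have [X hX] := equiv_tail hf (divr_gt0 e0 kappa_gt0).
exists (Num.max 1 X) => s y mu hs; rewrite ge_max => /andP[y1 Xy] _.
have y0 := lt_le_trans ltr01 y1; have [w we ->] := hX s y hs Xy.
have -> : `|s * y| = y by rewrite normrM (gtr0_norm y0); case: hs => ->; rewrite ?normrN normr1 mul1r.
have yi : 0 < (y `^ alpha)^-1 by rewrite invr_gt0 powR_gt0.
have -> : 1 * (kappa / y `^ alpha * (1 + w)) - kappa / y `^ alpha =
   (y `^ alpha)^-1 * (kappa * w) by ring.
rewrite normrM (gtr0_norm yi) [e / _]mulrC -[leRHS]mulrA ler_pM2l // normrM gtr0_norm //.
apply: (@le_trans _ _ e); first by rewrite mulrC -ler_pdivlMr.
by rewrite ler_peMr ?(ltW e0) // (le_trans _ (expR_ge1Dx _)) // lerDl mulr_ge0 // ltW.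
Qed.

(** A Potter-type bound: with [a = ln mu] and [b = ln y], the ratio of the logarithms
    is at most a power [1 / N] of [mu / y] or of [y / mu]. *)
Lemma ln_ratio_le (N a b : R) : 0 < N -> N <= a -> N <= b ->
  a / b <= expR (`|a - b| / N).
Proof.
move=> N0 Na Nb; have b0 := lt_le_trans N0 Nb.
apply: le_trans (expR_ge1Dx _).
have -> : a / b = 1 + (a - b) / b by field; rewrite gt_eqF.
rewrite lerD2l (le_trans (ler_norm _)) // normrM ler_wpM2l // normfV gtr0_norm //.
by rewrite lef_pV2.
Qed.

(** A tiny power of [exp x] is close to 1 relatively to the fixed power [eta]. *)
Lemma exp_small (th x : R) : 0 < th -> th <= eta / 2 -> 0 <= x ->
  expR (th * x) - 1 <= 2 * th / eta * expR (eta * x).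
Proof.
move=> th0 the x0.
have h1 : expR (th * x) - 1 <= th * x * expR (th * x).
  have := expR_ge1Dx (- (th * x)); rewrite expRN => h.
  have p := expR_gt0 (th * x).
  have := ler_wpM2r (ltW p) h; rewrite mulVf ?gt_eqF // mulrDl mul1r mulNr; lra.
apply: le_trans h1 _.
have h2 : eta / 2 * x <= expR (eta / 2 * x).
  by apply: le_trans (expR_ge1Dx _); rewrite lerDr.
have h3 : expR (th * x) <= expR (eta / 2 * x) by rewrite ler_expR ler_wpM2r.
have -> : expR (eta * x) = expR (eta / 2 * x) * expR (eta / 2 * x).
  by rewrite -expRD; congr expR; field.
have -> : th * x * expR (th * x) = 2 * th / eta * (eta / 2 * x * expR (th * x)).
  by field; move: eta_gt0; lra.
have e2 : 0 <= eta / 2 * x by rewrite mulr_ge0 // divr_ge0 // ltW.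
apply: ler_wpM2l; last by apply: ler_pM; rewrite ?expR_ge0.
by rewrite mulr_ge0 ?invr_ge0 ?(ltW eta_gt0) // mulr_ge0 // ltW.
Qed.

(** With [r = (ln mu / ln y) ^ beta], the rescaled error is
    [kappa (r (1 + w) - 1)]. The Potter bound gives [|ln r| <= th * d] for
    [d = |ln mu - ln y|] and [th] as small as desired, so [r - 1] and [r * w] are
    small multiples of [exp (eta * d)]. *)
Lemma log_tail f e :
  equiv_pm_infty f (fun y => kappa / (`|y| `^ alpha * ln `|y| `^ beta)) -> 0 < e ->
  exists X : R, forall s y mu, s = 1 \/ s = -1 -> X <= y -> X <= mu ->
  `|ln mu `^ beta * f (s * y) - kappa / y `^ alpha| <=
    e / y `^ alpha * expR (eta * `|ln mu - ln y|).
Proof.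
move=> hf e0; pose e1 := e / (2 * kappa).
have e10 : 0 < e1 by rewrite divr_gt0 // mulr_gt0.
have [X hX] := equiv_tail hf e10.
pose th := Num.min (eta / 2) (e1 * eta / 2).
have th0 : 0 < th by rewrite lt_min (divr_gt0 eta_gt0) ?divr_gt0 ?(mulr_gt0 e10).
have the : th <= eta / 2 by rewrite ge_min lexx.
have the1 : 2 * th / eta <= e1.
  rewrite ler_pdivrMr // -ler_pdivlMl // (_ : 2^-1 * _ = e1 * eta / 2) ?ge_min ?lexx ?orbT //.
  by ring.
(* N makes the exponent beta / N of the Potter bound equal to th *)
pose N := beta / th; have N0 : 0 < N by rewrite divr_gt0.
exists (Num.max (expR N) X) => s y mu hs; rewrite !ge_max => /andP[yN Xy] /andP[muN _].
have y0 := lt_le_trans (expR_gt0 N) yN; have mu0 := lt_le_trans (expR_gt0 N) muN.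
have lnN (v : R) : expR N <= v -> N <= ln v.
  by move=> Nv; rewrite -[N]expRK ler_ln ?posrE ?expR_gt0 // (lt_le_trans (expR_gt0 N)).
have ly := lnN y yN; have lmu := lnN mu muN.
have ly0 := lt_le_trans N0 ly; have lmu0 := lt_le_trans N0 lmu.
have [w we ->] := hX s y hs Xy.
have -> : `|s * y| = y by rewrite normrM (gtr0_norm y0); case: hs => ->; rewrite ?normrN normr1 mul1r.
have yi : 0 < (y `^ alpha)^-1 by rewrite invr_gt0 powR_gt0.
set d := `|ln mu - ln y|; have d0 : 0 <= d by exact: normr_ge0.
pose r := (ln mu / ln y) `^ beta.
have rE : r = ln mu `^ beta / ln y `^ beta.
  by rewrite /r powRM ?(ltW lmu0) ?invr_ge0 ?(ltW ly0) // powRV // ltW.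
have -> : ln mu `^ beta * (kappa / (y `^ alpha * ln y `^ beta) * (1 + w)) - kappa / y `^ alpha
    = (y `^ alpha)^-1 * (kappa * (r * (1 + w) - 1)).
  by rewrite rE; field; rewrite ?(gt_eqF (powR_gt0 _ y0)) ?(gt_eqF (powR_gt0 _ ly0)).
rewrite normrM (gtr0_norm yi) [e / _]mulrC -[leRHS]mulrA ler_pM2l // normrM gtr0_norm //.
have bound (a b : R) : N <= a -> N <= b -> `|a - b| = d -> (a / b) `^ beta <= expR (th * d).
  move=> Na Nb ab; have := ln_ratio_le N0 Na Nb; rewrite ab => h.
  have ab0 : 0 <= a / b by rewrite divr_ge0 // (le_trans (ltW N0)).
  have := ge0_ler_powR (ltW beta_gt0) (_ : a / b \is Num.nneg) (_ : expR (d / N) \is Num.nneg) h.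
  rewrite !nnegrE ab0 expR_ge0 => /(_ isT isT)/le_trans; apply.
  rewrite -expRM ler_expR /N invf_div le_eqVlt; apply/orP; left; apply/eqP.
  by field; rewrite gt_eqF.
have r_le : r <= expR (th * d) by apply: bound.
have r_ge : expR (- (th * d)) <= r.
  have h : (ln y / ln mu) `^ beta <= expR (th * d) by apply: bound => //; rewrite distrC.
  have r0 : 0 < r by rewrite powR_gt0 // divr_gt0.
  have ri : (ln y / ln mu) `^ beta = r^-1.
    by rewrite -invf_div powRV // divr_ge0 // ltW.
  by rewrite expRN -[leRHS]invrK -ri lef_pV2 ?posrE ?expR_gt0 // ri invr_gt0.
have small := exp_small th0 the d0.
have E1 : `|r - 1| <= e1 * expR (eta * d).
  have : e1 * expR (eta * d) >= 2 * th / eta * expR (eta * d) by rewrite ler_pM2r ?expR_gt0.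
  have := expR_ge1Dx (th * d); have := expR_ge1Dx (- (th * d)).
  have : 1 - expR (- (th * d)) <= expR (th * d) - 1.
    (* equivalent to 2 <= exp x + exp (- x) *)
    have := sqr_ge0 (expR (th * d / 2) - expR (- (th * d / 2))).
    rewrite sqrrB -!expRM_natl -expRD subrr expR0 /=.
    have -> : 2%:R * (th * d / 2) = th * d by field.
    have -> : 2%:R * (- (th * d / 2)) = - (th * d) by field.
    by lra.
  by rewrite ler_norml; lra.
have E2 : `|r * w| <= e1 * expR (eta * d).
  have r0 : 0 <= r by exact: powR_ge0.
  rewrite normrM (ger0_norm r0) mulrC ler_pM // (le_trans r_le) // ler_expR ler_wpM2r //.
  by move: the eta_gt0; lra.
have -> : r * (1 + w) - 1 = (r - 1) + r * w by ring.
have -> : e * expR (eta * d) = kappa * (e1 * expR (eta * d) + e1 * expR (eta * d)).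
  by rewrite /e1; field; rewrite gt_eqF.
by rewrite ler_pM2l // (le_trans (ler_normD _ _)) // lerD.
Qed.

Lemma one_small e : 0 < e -> exists X : R, forall mu, X <= mu ->
  1 <= e * mu `^ (1 - alpha).
Proof.
move=> e0; have [X hX] := @powR_large R (1 - alpha) e^-1 (ltac:(by rewrite subr_gt0)).
by exists X => mu /hX h; rewrite -ler_pdivrMl // mulr1.
Qed.

Lemma log_small e : 0 < e -> exists X : R, forall mu, X <= mu ->
  ln mu `^ beta <= e * mu `^ (1 - alpha).
Proof.
move=> e0; pose K := (beta / eta) `^ beta.
have [X hX] := @powR_large R eta (K / e) eta_gt0.
exists (Num.max 1 X) => mu; rewrite ge_max => /andP[mu1 /hX hK].
have mu0 := lt_le_trans ltr01 mu1.
have l0 : 0 <= ln mu by exact: ln_ge0.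
have K0 : 0 < K by rewrite powR_gt0 // divr_gt0.
have h1 : ln mu <= beta / eta * expR (eta / beta * ln mu).
  have k0 : 0 < beta / eta by exact: divr_gt0.
  rewrite -(ler_pdivrMl _ _ k0) invf_div.
  by apply: le_trans (expR_ge1Dx _); rewrite lerDr.
have h2 : ln mu `^ beta <= K * mu `^ eta.
  apply: le_trans (ge0_ler_powR (ltW beta_gt0) _ _ h1) _.
  - by rewrite nnegrE.
  - by rewrite nnegrE (le_trans l0).
  rewrite powRM ?expR_ge0 ?(ltW (divr_gt0 _ _)) // ler_pM2l // -expRM /powR gt_eqF //.
  by rewrite ler_expR le_eqVlt; apply/orP; left; apply/eqP; field; rewrite gt_eqF.
apply: le_trans h2 _.
have -> : mu `^ (1 - alpha) = mu `^ eta * mu `^ eta.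
  by rewrite /powR gt_eqF // -expRD; congr expR; field.
by rewrite mulrA ler_pM2r ?powR_gt0 // -ler_pdivrMl // mulrC.
Qed.

End tails.

(** * The rescaling factor *)

Section mu_log.
Context {R : realType}.
Variables alpha beta : R.
Hypotheses (alpha_gt0 : 0 < alpha) (alpha_lt1 : alpha < 1) (beta_gt0 : 0 < beta).
Implicit Types (m t s X : R).

Local Notation phi := (fun m : R => m `^ (1 + alpha) * ln m `^ beta).

Lemma mu_log_homo m m' : 1 < m -> m <= m' -> phi m <= phi m'.
Proof.
move=> m1 mm; have m0 := lt_trans ltr01 m1; have m'0 := lt_le_trans m0 mm.
have lm : ln m <= ln m' by rewrite ler_ln ?posrE.
have lm0 : 0 <= ln m by rewrite ln_ge0 // ltW.
apply: ler_pM; rewrite ?powR_ge0 //.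
  by apply: ge0_ler_powR; rewrite ?nnegrE ?addr_ge0 ?(ltW alpha_gt0) ?(ltW m0) ?(ltW m'0).
by apply: ge0_ler_powR; rewrite ?nnegrE ?(ltW beta_gt0) // (le_trans lm0).
Qed.

(** The intermediate value theorem in the variable [s = ln m], where small
    values come from the factor [s ^ beta] and large ones from the exponential. *)
Lemma mu_log_image t : 0 < t -> (phi @` `]1, +oo[) t.
Proof.
move=> t0; pose psi s := expR ((1 + alpha) * s) * s `^ beta.
pose a := Num.min 1 ((t / expR 2) `^ beta^-1).
have a0 : 0 < a by rewrite lt_min ltr01 powR_gt0 // divr_gt0 ?expR_gt0.
have a1 : a <= 1 by rewrite ge_min lexx.
pose b := Num.max 1 t; have b1 : 1 <= b by rewrite le_max lexx.
have ab : a <= b := le_trans a1 b1.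
have psia : psi a <= t.
  have -> : t = expR 2 * (t / expR 2) by rewrite mulrC divfK // gt_eqF // expR_gt0.
  apply: ler_pM; rewrite ?expR_ge0 ?powR_ge0 //.
    rewrite ler_expR; have := alpha_lt1; have : alpha * a <= 1 * 1.
      by rewrite ler_pM // ltW.
    by rewrite mulrDl; move: a1; lra.
  have te : 0 <= t / expR 2 by rewrite divr_ge0 ?expR_ge0 // ltW.
  have := ge0_ler_powR (ltW beta_gt0) (_ : a \is Num.nneg)
    (_ : (t / expR 2) `^ beta^-1 \is Num.nneg) (_ : a <= (t / expR 2) `^ beta^-1).
  rewrite !nnegrE (ltW a0) powR_ge0 ge_min lexx orbT => /(_ isT isT isT).
  by rewrite -powRrM mulVf ?gt_eqF // powRr1.
have psib : t <= psi b.
  have bt : t <= expR ((1 + alpha) * b).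
    apply: le_trans (expR_ge1Dx _).
    have : t <= b by rewrite le_max lexx orbT.
    have : 0 <= alpha * b by rewrite mulr_ge0 ?(ltW alpha_gt0) // (le_trans ler01).
    by rewrite mulrDl; lra.
  apply: le_trans bt _; rewrite ler_peMr ?expR_ge0 //.
  by have := ler_powR b1 (ltW beta_gt0); rewrite powRr0.
have [||s] := @IVT R psi a b t ab.
- apply: continuous_in_subspaceT => s; rewrite inE/= in_itv/= => /andP[sa _].
  have s0 : 0 < s := lt_le_trans a0 sa.
  have cp : {for s, continuous (@powR R ^~ beta)}.
    apply/differentiable_continuous/derivable1_diffP.
    by case: (is_derive1_powR beta s0).
  apply: cvgM; last exact: cp.
  apply: continuous_comp; last exact: continuous_expR.
  by apply: cvgMr.
- by rewrite ge_min le_max psia psib orbT.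
- rewrite in_itv/= => /andP[sa _] st; have s0 := lt_le_trans a0 sa.
  exists (expR s); first by rewrite /= in_itv/= andbT expR_gt1.
  by rewrite expRK -expRM mulrC -st /psi [s * _]mulrC mulrC.
Qed.

(** [phi] is bounded by [phi Y] on [1 < m <= Y], so its inverse tends to infinity. *)
Lemma mu_logP X : \forall t \near +oo,
  X <= mu_log alpha beta t /\ phi (mu_log alpha beta t) = t.
Proof.
pose Y := Num.max 2 X.
near=> t.
have t0 : 0 < t by near: t; exact: nbhs_pinfty_gt.
have tY : phi Y < t by near: t; apply: nbhs_pinfty_gt; exact: num_real.
have [/=] := pinv_image_spec (mu_log_image t0).
rewrite in_itv/= andbT -/(mu_log alpha beta t) => m1 mt; split => //.
have [//|mX] := leP X (mu_log alpha beta t).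
suff : phi (mu_log alpha beta t) <= phi Y by rewrite mt leNgt tY.
by apply: mu_log_homo => //; rewrite le_max (ltW mX) orbT.
Unshelve. all: by end_near. Qed.

End mu_log.

(** * Convergence to the profile *)

Lemma uniform_cvg_near (R : realType) (A : set R) (F : R -> R -> R) (p : R -> R) :
  (forall tau : R, 0 < tau -> \forall t \near +oo, forall z, A z -> `|F t z - p z| <= tau) ->
  {uniform A, F t @[t --> +oo] --> p}.
Proof.
move=> H W /uniform_nbhs[E [entE EW]].
move: entE; rewrite -entourage_from_ballE => -[e /= e0 eE].
have := H (e / 2) (ltac:(by rewrite divr_gt0)).
apply: filterS => t h; apply: EW => y Ay; apply: eE => /=.
by rewrite /ball /= distrC (le_lt_trans (h y Ay)) // ltr_pdivrMr // ltr_pMr // ltr1n.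
Qed.

Theorem proposition1p8 (R : realType) (kappa alpha beta : R)
  (kappa_gt0 : 0 < kappa) (alpha_gt0 : 0 < alpha) (alpha_lt1 : alpha < 1)
  (beta_gt0 : 0 < beta) :
  exists zc : R,
  [/\ gfun kappa alpha (y0 kappa alpha) < zc,
   forall f0 : R -> R, C1 f0 ->
     equiv_pm_infty f0 (fun y => kappa / (`|y| `^ alpha * ln `|y| `^ beta)) ->
     equiv_pm_infty f0^`()%classic
       (fun y => - alpha * kappa / (y * `|y| `^ alpha * ln `|y| `^ beta)) ->
     let mu := mu_log alpha beta in
     let f := burgers_solution f0 in
     (forall z : R, z != zc ->
        t / mu t * f (z * mu t) t @[t --> +oo] --> profile kappa alpha zc z) /\
     (forall eps : R, 0 < eps ->
        {uniform `[- eps^-1, eps^-1] `\` `[zc - eps, zc + eps],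
          (fun z => t / mu t * f (z * mu t) t) @[t --> +oo] -->
          profile kappa alpha zc}) &
   forall f0 : R -> R, C1 f0 ->
     equiv_pm_infty f0 (fun y => kappa / `|y| `^ alpha) ->
     equiv_pm_infty f0^`()%classic (fun y => - alpha * kappa / (y * `|y| `^ alpha)) ->
     let f := burgers_solution f0 in
     forall z : R, z != zc ->
       t `^ (alpha / (1 + alpha)) * f (z * t `^ (1 + alpha)^-1) t
         @[t --> +oo] --> profile kappa alpha zc z].
Proof.
(* zc depends on kappa and alpha only: both families of data share the profile *)
have [zc zc_gt zc_min] := global_min_switch kappa_gt0 alpha_gt0 alpha_lt1.
have C1_cont (f0 : R -> R) : C1 f0 -> continuous f0.
  by move=> [df _] y; apply/differentiable_continuous/derivable1_diffP.
exists zc; split => // f0 /C1_cont cf0 f0_tail _.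
- move=> mu f.
  have main M d tau : 0 < d -> 0 < tau -> \forall t \near +oo,
      forall z, `|z| <= M -> d <= `|z - zc| ->
      `|t / mu t * f (z * mu t) t - profile kappa alpha zc z| <= tau.
    move=> d0 tau0.
    have [|mu0 mu1|e e0|e e0|X hX] := @burgers_profile R kappa alpha kappa_gt0 alpha_gt0
      alpha_lt1 f0 (fun m => ln m `^ beta) cf0 _ _ _ _ zc zc_gt zc_min M d tau d0 tau0.
    + by move=> *; exact: powR_ge0.
    + by rewrite powR_gt0 // ln_gt0.
    + exact: log_tail e0.
    + exact: log_small.
    near=> t => z zM zd.
    have [Xmu mut] : X <= mu t /\ mu t `^ (1 + alpha) * ln (mu t) `^ beta = t.
      by near: t; exact: mu_logP.
    by have := hX _ _ Xmu zM zd; rewrite mut profileE.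
  split=> [z zzc|eps eps0].
    apply/cvgrPdist_le => tau tau0.
    have d0 : 0 < `|z - zc| by rewrite normr_gt0 subr_eq0.
    have := main `|z| _ tau d0 tau0; apply: filterS => t /(_ z (lexx _) (lexx _)).
    by rewrite distrC.
  apply: uniform_cvg_near => tau tau0.
  have := main eps^-1 eps tau eps0 tau0; apply: filterS => t + z /= [].
  rewrite !in_itv /= -ler_norml => h zM zn; apply: h => //.
  rewrite leNgt; apply/negP => zd; apply: zn; move: zd; rewrite ltr_norml => /andP[].
  by move=> h1 h2; apply/andP; split; lra.
- move=> f z zzc; apply/cvgrPdist_le => tau tau0.
  have d0 : 0 < `|z - zc| by rewrite normr_gt0 subr_eq0.
  have [|mu0 mu1|e e0|e e0|X hX] := @burgers_profile R kappa alpha kappa_gt0 alpha_gt0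
      alpha_lt1 f0 (fun=> 1) cf0 _ _ _ _ zc zc_gt zc_min `|z| _ tau d0 tau0.
  + by [].
  + by [].
  + exact: power_tail e0.
  + exact: one_small.
  have a10 : 0 < 1 + alpha by rewrite addr_gt0.
  have [Y hY] := @powR_large R (1 + alpha)^-1 X (ltac:(by rewrite invr_gt0)).
  near=> t.
  have t0 : 0 < t by near: t; exact: nbhs_pinfty_gt.
  have Yt : Y <= t by near: t; apply: nbhs_pinfty_ge; exact: num_real.
  have := hX _ z (hY t Yt) (lexx _) (lexx _); rewrite mulr1 -powRrM mulVf ?gt_eqF //.
  rewrite powRr1 ?(ltW t0) // profileE // distrC.
  suff -> : t `^ (alpha / (1 + alpha)) = t / t `^ (1 + alpha)^-1 by [].
  have -> : alpha / (1 + alpha) = 1 - (1 + alpha)^-1 by field; rewrite gt_eqF.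
  by rewrite powRB ?powRr1 ?(ltW t0) // (gt_eqF t0) implybT.
Unshelve. all: by end_near. Qed.
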